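(* Consider the Bass model on a general network with node set $\mathcal{M}=\{1,\dots,M\}$. For any promotion $\mathbf{s}(t):=(s_p(t),s_q(t))\in\mathcal{S}^2$, let $\{[S_\Omega]\}_{\emptyset\neq\Omega\subset\mathcal{M}}$ and $\{\Psi_\Omega\}_{\emptyset\neq\Omega\subset\mathcal{M}}$ be the solutions to the coupled boundary-value problems $$\frac{d[S_{\Omega}]}{dt}=-\Big(p_\Omega(s_p(t))+\sum_{k\in\Omega^c}q_{k\to\Omega}(s_q(t))\Big)[S_{\Omega}]+\sum_{k\in\Omega^c}q_{k\to\Omega}(s_q(t))[S_{\Omega,k}],\qquad [S_\Omega](0)=1,$$ $$\frac{d\Psi_{\Omega}}{dt}=\Big(\Psi_\Omega(t)-\mathbf{1}_{|\Omega|=1}\frac{\gamma}{M}e^{-\theta t}\Big)\Big(p_\Omega(s_p(t))+\sum_{k\in\Omega^c}q_{k\to\Omega}(s_q(t))\Big)-\sum_{m\in\Omega}\Big(\mathbf{1}_{|\Omega|>1}\Psi_{\Omega\setminus\{m\}}(t)-\mathbf{1}_{|\Omega|=2}\frac{\gamma}{M}e^{-\theta t}\Big)q_{m\to\Omega\setminus\{m\}}(s_q(t)),\qquad \Psi_\Omega(T)=0.$$ Then the optimal promotion $\mathbf{s}^{\rm opt}:=(s_p^{\rm opt},s_q^{\rm opt})$, i.e. the maximizer of $\Pi[\mathbf{s}(t)]$ over $\mathcal{S}^2$, satisfies the condition $$\frac{\partial H}{\partial s_p}=\frac{\partial H}{\partial s_q}=0,\qquad H:=\Big(-\frac{\gamma}{M}\sum_{j=1}^{M}\frac{d[S_j]}{dt}-\big(s_p(t)+s_q(t)\big)\Big)e^{-\theta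 t}+\sum_{\emptyset\neq\Omega\subset\mathcal{M}}\Psi_\Omega(t)\frac{d[S_\Omega]}{dt},$$ where in $H$ the derivatives $\frac{d[S_\Omega]}{dt}$ (including $\frac{d[S_j]}{dt}$) stand for the right-hand sides of the first equation.
   Context: Bass model on a network: the state of node $j\in\mathcal{M}=\{1,\dots,M\}$ at time $t$ is a random variable $X_j(t)\in\{0,1\}$ ($1$ = adopter), with $X_j(0)=0$. Under a promotion $\mathbf{s}(t)=(s_p(t),s_q(t))$ (spending rates per consumer), a nonadopter $j$ adopts at rate $\lambda_j(t)=p_j(s_p(t))+\sum_{k=1}^M q_{k\to j}(s_q(t))X_k(t)$, where $p_j$ is the rate of external influences on $j$ and $q_{k\to j}$ is the rate of internal influences of $k$ on $j$, and adopters remain adopters; i.e. as $\Delta t\to0$, $\mathbb{P}(X_j(t+\Delta t)=1\mid X_1(t),\dots,X_M(t))$ equals $1$ if $X_j(t)=1$ and $\lambda_j(t)\Delta t$ if $X_j(t)=0$. $T$ is the planning horizon, $\mathcal{S}$ is the set of piecewise-continuous functions from $[0,T]$ to the nonnegative reals, $\theta$ is the discount rate, $\gamma$ is the income generated by the sale of one unit of the product. The expected adoption level is $f(t)=\frac1M\sum_{j=1}^M\mathbf{E}[X_j(t)]$ and the expected accumulated discounted profit per consumer is $\Pi[\mathbf{s}(t)]=\int_0^T e^{-\theta t}\big(\gamma\frac{df}{dt}-(s_p(t)+s_q(t))\big)dt$. Notation: for $\emptyset\ne\Omega\subset\mathcal{M}$ (including $\Omega=\mathcal{M}$), $\Omega^c=\mathcal{M}\setminus\Omega$;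 $[S_\Omega](t)=\mathbb{P}(X_m(t)=0\ \text{for all } m\in\Omega)$; $[S_j]=[S_{\{j\}}]$; $[S_{\Omega,k}]=[S_{\Omega\cup\{k\}}]$; $p_\Omega=\sum_{m\in\Omega}p_m$; $q_{k\to\Omega}=\sum_{m\in\Omega}q_{k\to m}$. $\mathbf{1}$ denotes an indicator.
   Formalization: Each partial derivative of H is shown to vanish only when that component of s^opt(t) is positive (constant p, q give s^opt=0 with ∂H/∂s_p≠0) and at times where s^opt is continuous; p_j, q_{k→j} are assumed nonnegative, continuous, and differentiable for positive spending. *)

(* Defs.v *)
(* MathComp / MathComp-Analysis *)
From HB Require Import structures.
From mathcomp Require Import all_boot all_order all_algebra.
From mathcomp Require Import all_classical all_reals all_analysis.

Set Implicit Arguments.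
Unset Strict Implicit.
Unset Printing Implicit Defensive.

Import Order.TTheory GRing.Theory Num.Theory.
Import numFieldNormedType.Exports.

Local Open Scope classical_set_scope.
Local Open Scope ring_scope.

(* The node set is 'I_M.  [q k j] is the rate q_{k->j} of internal influences
   of k on j; sets of nodes are finite sets [W : {set 'I_M}], and [%SET] selects
   the finset (as opposed to classical_sets) notations. *)

Section Promotions.
Variable R : realType.

(* Promotions are total functions of time; only their values on the planning
   period [0, T] matter. *)
Record promotion := Promotion { s_p : R -> R ; s_q : R -> R }.

Definition continuous_on_at (T : R) (g : R -> R) (t : R) : Prop :=
  g x @[x --> within `[0, T] (nbhs t)] --> g t.

(* The value at a jump is unconstrained. *)
Definition piecewise_continuous (T : R) (g : R -> R) : Prop :=
  [/\ exists D : seq R, forall t : R, 0 <= t <= T -> t \notin D ->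
        continuous_on_at T g t,
      forall t : R, 0 <= t < T -> cvg (g x @[x --> t^'+])
    & forall t : R, 0 < t <= T -> cvg (g x @[x --> t^'-])].

Definition spending_rate (T : R) (g : R -> R) : Prop :=
  piecewise_continuous T g /\ (forall t : R, 0 <= t <= T -> 0 <= g t).

Definition admissible (T : R) (s : promotion) : Prop :=
  spending_rate T (s_p s) /\ spending_rate T (s_q s).

Definition regular_time (T : R) (s : promotion) (t : R) : Prop :=
  continuous_on_at T (s_p s) t /\ continuous_on_at T (s_q s) t.

(* Standing regularity of the response of an influence rate to spending.
   Differentiability is not required at zero spending, so that for instance
   u |-> a + b * Num.sqrt u is allowed. *)
Definition influence_rate (r : R -> R) : Prop :=
  [/\ forall u : R, 0 <= u -> 0 <= r u,
      {within `[0, +oo[, continuous r}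
    & forall u : R, 0 < u -> derivable r u 1].

End Promotions.

Section BassModel.
Variables (R : realType) (M : nat).
Variables (p : 'I_M -> R -> R) (q : 'I_M -> 'I_M -> R -> R).

(* The adoption rate of j when the set of adopters is A. *)
Definition adoption_rate (u v : R) (A : {set 'I_M}) (j : 'I_M) : R :=
  p j u + \sum_(k < M) q k j v * (k \in A)%:R.

Section Process.
Context d (Om : measurableType d).
Variables (P : probability Om R) (X : 'I_M -> R -> Om -> bool).

Definition adopters (t : R) (w : Om) : {set 'I_M} := [set j | X j t w]%SET.

Definition cond_prob (E F : set Om) : R := fine (P (E `&` F)) / fine (P F).

(* Conditioning on X_1(t), ..., X_M(t) is conditioning on the events
   [adopters t w = A] of positive probability.  The last two clauses make
   explicit what the one-node infinitesimal law leaves implicit: two nodes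
   adopt in the same interval of length h with probability o(h), and no node
   adopts at a predetermined time with positive probability.  The latter is
   what excludes jumps of the law at the discontinuities of s, where no
   rate is prescribed. *)
Record bass_process (T : R) (s : promotion R) : Prop := BassProcess {
  bass_measurable : forall j (t : R), 0 <= t <= T -> measurable_fun setT (X j t) ;
  bass_initial : forall j, P [set w | X j 0 w] = 0%E ;
  bass_adopter : forall (t t' : R) A j, 0 <= t -> t <= t' -> t' <= T ->
    P [set w | adopters t w = A] != 0%E -> j \in A ->
    cond_prob [set w | X j t' w] [set w | adopters t w = A] = 1 ;
  bass_nonadopter : forall (t : R) A j, 0 <= t < T -> regular_time T s t ->
    P [set w | adopters t w = A] != 0%E -> j \notin A ->
    cond_prob [set w | X j (t + h) w] [set w | adopters t w = A] / h
      @[h --> 0^'+] --> adoption_rate (s_p s t) (s_q s t) A j ;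
  bass_simple : forall (t : R) A i j, 0 <= t < T -> regular_time T s t ->
    P [set w | adopters t w = A] != 0%E ->
    i \notin A -> j \notin A -> i != j ->
    cond_prob [set w | X i (t + h) w /\ X j (t + h) w]
              [set w | adopters t w = A] / h
      @[h --> 0^'+] --> (0 : R) ;
  bass_no_fixed_jump : forall j (t : R), 0 <= t <= T ->
    continuous_on_at T (fun t' => fine (P [set w | X j t' w])) t
}.

Definition adoption_level (t : R) : R :=
  M%:R^-1 * \sum_(j < M) fine ('E_P [fun w => (X j t w)%:R : R])%E.

(* df/dt exists at all but finitely many times, which do not contribute to
   the integral. *)
Definition profit (T theta gamma : R) (s : promotion R) : R :=
  \int[lebesgue_measure]_(t in `[0, T])
     (expR (- theta * t) *
      (gamma * derive1 adoption_level t - (s_p s t + s_q s t))).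

End Process.

Definition p_set (W : {set 'I_M}) (u : R) : R := \sum_(m in W) p m u.

Definition q_set (k : 'I_M) (W : {set 'I_M}) (v : R) : R :=
  \sum_(m in W) q k m v.

Definition outflow (u v : R) (W : {set 'I_M}) : R :=
  p_set W u + \sum_(k in (~: W)%SET) q_set k W v.

Definition S_rhs (u v : R) (x : {set 'I_M} -> R) (W : {set 'I_M}) : R :=
  - outflow u v W * x W
  + \sum_(k in (~: W)%SET) q_set k W v * x (k |: W)%SET.

Definition Psi_rhs (theta gamma t u v : R) (y : {set 'I_M} -> R)
    (W : {set 'I_M}) : R :=
  let g := gamma / M%:R * expR (- theta * t) in
  (y W - (#|W| == 1)%:R * g) * outflow u v W
  - \sum_(m in W)
      ((1 < #|W|)%N%:R * y (W :\ m)%SET - (#|W| == 2)%:R * g)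
      * q_set m (W :\ m)%SET v.

(* With a piecewise continuous right-hand side, a solution is continuous on
   [0, T] and satisfies the equation at the times where s is continuous. *)
Definition S_solution (T : R) (s : promotion R)
    (S : {set 'I_M} -> R -> R) : Prop :=
  forall W, W != finset.set0 ->
  [/\ forall t : R, 0 <= t <= T -> continuous_on_at T (S W) t,
      S W 0 = 1
    & forall t : R, 0 < t < T -> regular_time T s t ->
      is_derive t 1 (S W) (S_rhs (s_p s t) (s_q s t) (S ^~ t) W)].

Definition Psi_solution (T theta gamma : R) (s : promotion R)
    (Psi : {set 'I_M} -> R -> R) : Prop :=
  forall W, W != finset.set0 ->
  [/\ forall t : R, 0 <= t <= T -> continuous_on_at T (Psi W) t,
      Psi W T = 0
    & forall t : R, 0 < t < T -> regular_time T s t ->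
      is_derive t 1 (Psi W)
        (Psi_rhs theta gamma t (s_p s t) (s_q s t) (Psi ^~ t) W)].

Definition hamiltonian (theta gamma t : R) (x y : {set 'I_M} -> R)
    (u v : R) : R :=
  (- (gamma / M%:R) * \sum_(j < M) S_rhs u v x [set j]%SET - (u + v))
    * expR (- theta * t)
  + \sum_(W : {set 'I_M} | W != finset.set0) y W * S_rhs u v x W.

End BassModel.

(* Main.v *)
(* Pontryagin's maximum principle by needle variations.  The survival
   probabilities [S] of the process solve the first system: conditioning on the
   set of adopters at time t and Bonferroni's inequalities give their right
   derivative, and a continuous function whose right derivative is continuous
   at a point is differentiable there.  Since the Hamiltonian is affine in [S]
   and the costates [Psi] solve the adjoint system of [s], the profits of
   another promotion [s'] and of [s] differ exactly by the integral of
   H(t, S', Psi, s') - H(t, S', Psi, s), where [S'] are the survival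
   probabilities under [s'].  If some constant spending (u, v) had a larger
   Hamiltonian than [s] at a time t, then switching to (u, v) on a short
   interval starting at t would increase the profit.  So the spending rates
   maximize the Hamiltonian, and the maximum is interior when they are
   positive. *)
Require Import Defs.
From HB Require Import structures.
From mathcomp Require Import all_boot all_order all_algebra.
From mathcomp Require Import all_classical all_reals all_analysis.
From mathcomp Require Import ring lra.
Set Implicit Arguments.
Unset Strict Implicit.
Unset Printing Implicit Defensive.
Import Order.TTheory GRing.Theory Num.Theory.
Import numFieldNormedType.Exports.
Local Open Scope classical_set_scope.
Local Open Scope ring_scope.

(** * One-sided derivatives *)

(** The law of the process prescribes right derivatives only, and none at the discontinuities of
    [s]; the monotonicity arguments therefore allow a finite exceptional set [D], where continuity
    alone is used. Processes under different promotions live on unrelated probability spaces, so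
    paths cannot be coupled: two promotions are compared through their survival probabilities, by
    uniqueness for the first system. The exact profit formula replaces a first-order expansion in
    the length of the needle: off the needle the promotions agree and the Hamiltonians cancel,
    although the survival probabilities stay perturbed afterwards. One circularity remains, since
    the length has to be chosen from the survival probabilities that the needle itself produces. It
    is broken by a needle lasting until [T]: its survival probabilities coincide with those of any
    shorter needle for as long as the latter lasts. *)

Lemma right_nbhs_interval (R : realType) (c b : R) (Q : R -> Prop) :
  c < b -> (\forall y \near c^'+, Q y) ->
  exists2 e, c < e <= b & forall y, c < y <= e -> Q y.
Proof.
move=> cb [e /= e0 H].
exists (Num.min b (c + e / 2)).
  by rewrite lt_min cb/= ltrDl divr_gt0//= ge_min lexx.
move=> y /andP[cy]; rewrite le_min => /andP[_ ye]; apply: H => //=.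
rewrite distrC ger0_norm ?subr_ge0 1?ltW// ltrBlDl.
by rewrite (le_lt_trans ye)// ltrD2l ltr_pdivrMr// ltr_pMr// ltr1n.
Qed.

Lemma at_right_within (R : realType) (a b c : R) :
  a <= c < b -> c^'+ --> within `[a, b] (nbhs c).
Proof.
move=> /andP[ac cb] A; rewrite /within/= => HA.
apply: filterS2 (lt_le_nbhsl cb) HA => x xb Ax cx.
by apply: Ax; rewrite /= in_itv/= xb (le_trans ac (ltW cx)).
Qed.

Lemma at_left_within (R : realType) (a b c : R) :
  a < c <= b -> c^'- --> within `[a, b] (nbhs c).
Proof.
move=> /andP[ac cb] A; rewrite /within/= => HA.
apply: filterS2 (lt_le_nbhsr ac) HA => x ax Ax xc.
by apply: Ax; rewrite /= in_itv/= ax (le_trans (ltW xc) cb).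
Qed.

Lemma nbhs_within_itv (R : realType) (a b c : R) :
  a < c < b -> nbhs c --> within `[a, b] (nbhs c).
Proof.
move=> /andP[ac cb] A; rewrite /within/= => HA.
apply: filterS3 (lt_le_nbhsr ac) (lt_le_nbhsl cb) HA => x ax xb Ax.
by apply: Ax; rewrite /= in_itv/= ax xb.
Qed.

Lemma count_lt_mem (R : realType) (D : seq R) (c y : R) :
  c \in D -> c < y -> (count (< c)%R D < count (< y)%R D)%N.
Proof.
move=> + cy; elim: D => //= z D IH; rewrite inE => /predU1P[<-|cD].
  rewrite ltxx cy add0n add1n ltnS; apply: sub_count => x /= xc.
  exact: lt_trans xc cy.
rewrite -addnS leq_add ?IH//; case: (ltP z c) => // zc.
by rewrite (lt_trans zc cy).
Qed.

(* The defect [e * count (< x) D] absorbs the points where nothing is known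
   about the derivative. *)
Lemma right_derivative_defect (R : realType) (a b e : R) (f : R -> R) (D : seq R) :
  0 < e -> a <= b ->
  (forall t, a <= t <= b -> f x @[x --> within `[a, b] (nbhs t)] --> f t) ->
  (forall t, a <= t < b -> t \notin D ->
     exists2 l : R, 0 <= l & (f (t + h) - f t) / h @[h --> 0^'+] --> l) ->
  f a <= f b + e * (b - a) + e * (count (< b) D)%:R.
Proof.
move=> e0 ab fc fd.
pose Q y := f a <= f y + e * (y - a) + e * (count (< y) D)%:R.
have cntS (x y : R) : x <= y -> ((count (< x)%R D)%:R <= (count (< y)%R D)%:R :> R).
  by move=> xy; rewrite ler_nat; apply: sub_count => z /= /lt_le_trans; apply.
pose E := [set x | a <= x <= b /\ forall y, a <= y <= x -> Q y].
have Qa : Q a by rewrite /Q subrr mulr0 addr0 lerDl mulr_ge0// ltW.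
have Ea : E a.
  split; first by rewrite lexx.
  by move=> y; rewrite -eq_le => /eqP <-.
have Eub : ubound E b by move=> x [/andP[]].
have hsE : has_sup E by split; [exists a | exists b].
pose c := sup E.
have ac : a <= c by apply: ub_le_sup => //; exists b.
have cb : c <= b by apply: ge_sup => //; exists a.
have Qlt y : a <= y < c -> Q y.
  move=> /andP[ay yc].
  have [z [_ Ez] yz] := sup_gt (ex_intro _ a Ea) yc.
  by apply: Ez; rewrite ay ltW.
have Qc : Q c.
  move: ac; rewrite le_eqVlt => /predU1P[<-//|ac].
  have fl : f y + e * (c - a) + e * (count (< c) D)%:R @[y --> c^'-] -->
            f c + e * (c - a) + e * (count (< c) D)%:R.
    apply: cvgD; last exact: cvg_cst.
    apply: cvgD; last exact: cvg_cst.
    apply: cvg_trans (fc c _); last by rewrite ltW.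
    by apply: cvg_app; apply: at_left_within; rewrite ac cb.
  rewrite /Q; apply: (cvgr_to_ge fl); near=> y.
  have yc : y < c by near: y; exact: nbhs_left_lt.
  have : Q y by apply: Qlt; rewrite yc andbT; near: y; exact: nbhs_left_ge.
  move=> /le_trans; apply; rewrite lerD//.
    by rewrite lerD2l ler_pM2l// lerB// ltW.
  by rewrite ler_pM2l// cntS// ltW.
have [ncb|bc] := ltP c b; last first.
  by have -> : b = c by apply/eqP; rewrite eq_le cb bc.
suff [z cz Ez] : exists2 z, c < z & E z.
  by have := ub_le_sup (ex_intro _ b Eub) Ez; rewrite leNgt cz.
have next : \forall y \near c^'+, Q y.
  (* At a point of [D], continuity bounds the drop of [f] by [e], which is paid by the strict
     counter, as it counts [c] only beyond [c]. Elsewhere the difference quotient exceeds [- e],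
     which is paid by the slope [e]. *)
  have [cD|cD] := boolP (c \in D).
    have fr : f y @[y --> c^'+] --> f c.
      apply: cvg_trans (fc c _); last by rewrite ac.
      by apply: cvg_app; apply: at_right_within; rewrite ac ncb.
    have fce : f c - e < f c by rewrite ltrBlDr ltrDl.
    near=> y.
    have cy : c < y by near: y; exact: nbhs_right_gt.
    have fy : f c - e <= f y.
      by near: y; exact: (cvgr_ge _ fr).
    have cnt : ((count (< c)%R D)%:R + 1 <= (count (< y)%R D)%:R :> R).
      by rewrite natr1 ler_nat count_lt_mem.
    move: Qc; rewrite /Q => /le_trans; apply.
    have : e * ((count (< c) D)%:R + 1) <= e * (count (< y) D)%:R by rewrite ler_pM2l.
    have : e * (c - a) <= e * (y - a) by rewrite ler_pM2l// lerB// ltW.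
    lra.
  have [|l l0 dl] := fd c _ cD; first by rewrite ac.
  have Nel : - e < l by rewrite (lt_le_trans _ l0)// oppr_lt0.
  have H : \forall h \near 0^'+, - e < (f (c + h) - f c) / h.
    exact: cvgr_gt dl _ Nel.
  have : \forall h \near 0^'+, 0 < h -> Q (c + h).
    near=> h => h0.
    have : - e < (f (c + h) - f c) / h by near: h.
    rewrite ltr_pdivlMr// => fh.
    have := cntS c (c + h); rewrite lerDl ltW// => /(_ isT).
    rewrite -(ler_pM2l e0) => cn.
    by move: Qc; rewrite /Q; lra.
  move=> [r /= r0 Hr]; exists r => // y /= yr cy.
  have -> : y = c + (y - c) by lra.
  apply: Hr; rewrite /= ?subr_gt0// sub0r opprB -normrN opprB.
  by rewrite distrC in yr *.
have [z /andP[cz zb] Hz] := right_nbhs_interval ncb next.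
exists z => //; split; first by rewrite zb (le_trans ac)// ltW.
move=> y /andP[ay yz]; have [yc|cy] := ltP y c; first by apply: Qlt; rewrite ay.
move: cy; rewrite le_eqVlt => /predU1P[<-//|cy].
by apply: Hz; rewrite cy.
Unshelve. all: end_near. Qed.

(** The coefficient of [e] in the defect depends on [a], [b] and [D] only, so the defect can be made
    as small as desired; the [+ 1] in [K] keeps the divisor positive. *)
Lemma right_derivative_mono (R : realType) (a b : R) (f : R -> R) (D : seq R) :
  a <= b ->
  (forall t, a <= t <= b -> f x @[x --> within `[a, b] (nbhs t)] --> f t) ->
  (forall t, a <= t < b -> t \notin D ->
     exists2 l : R, 0 <= l & (f (t + h) - f t) / h @[h --> 0^'+] --> l) ->
  f a <= f b.
Proof.
move=> ab fc fd; apply/ler_addgt0Pr => e e0.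
pose K := (b - a) + (count (< b)%R D)%:R + 1.
have K0 : 0 < K by rewrite ltr_pwDr// addr_ge0// subr_ge0.
have := right_derivative_defect (divr_gt0 e0 K0) ab fc fd.
move=> /le_trans; apply; rewrite -addrA lerD2l -mulrDr.
by rewrite -mulrA ler_piMr ?(ltW e0)// ler_pdivrMl// mulr1 lerDl.
Qed.

Lemma is_derive_right (R : realType) (f : R -> R) (t l : R) :
  is_derive t 1 f l -> (f (t + h) - f t) / h @[h --> 0^'+] --> l.
Proof.
move=> [df <-]; have := cvg_dnbhs_at_right df.
rewrite -/(derive f t 1); apply: cvg_trans; apply: near_eq_cvg.
by near=> h; rewrite /= [h *: 1]mulr1 [h + t]addrC [_ *: _]mulrC.
Unshelve. all: end_near. Qed.

Lemma derive_mono (R : realType) (a b : R) (f : R -> R) (D : seq R) :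
  a <= b ->
  (forall t, a <= t <= b -> f x @[x --> within `[a, b] (nbhs t)] --> f t) ->
  (forall t, a < t < b -> t \notin D ->
     exists2 l : R, 0 <= l & is_derive t 1 f l) ->
  f a <= f b.
Proof.
move=> ab fc fd; apply: (@right_derivative_mono _ _ _ _ (a :: D)) => //.
move=> t /andP[]; rewrite le_eqVlt => /predU1P[<-|at_]; rewrite inE ?eqxx// negb_or.
move=> tb /andP[_ tD]; have [|l l0 dl] := fd t _ tD; first by rewrite at_ tb.
by exists l => //; exact: is_derive_right.
Qed.

Lemma cvg_withinS (R : realType) (A B : set R) (t : R) (f : R -> R) :
  A `<=` B -> f x @[x --> within B (nbhs t)] --> f t ->
  f x @[x --> within A (nbhs t)] --> f t.
Proof.
by move=> AB; apply: cvg_trans; apply: cvg_app; exact: within_subset.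
Qed.

Lemma subset_itvcc (R : realType) (a b a' b' : R) : a' <= a -> b <= b' ->
  `[a, b]%classic `<=` `[a', b']%classic.
Proof.
move=> aa bb x /=; rewrite !in_itv/= => /andP[ax xb].
by rewrite (le_trans aa ax) (le_trans xb bb).
Qed.

(** Mean value inequality: monotonicity is applied to [f] minus the line of slope [c - e], and to
    the line of slope [c + e] minus [f]. The sign [k] in [key] treats both at once. *)
Lemma right_derivative_bound (R : realType) (a b : R) (f rho : R -> R)
    (D : seq R) (c e : R) :
  a <= b ->
  (forall t, a <= t <= b -> f x @[x --> within `[a, b] (nbhs t)] --> f t) ->
  (forall t, a <= t < b -> t \notin D ->
     (f (t + h) - f t) / h @[h --> 0^'+] --> rho t) ->
  (forall t, a <= t < b -> t \notin D -> `|rho t - c| <= e) ->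
  `|f b - f a - c * (b - a)| <= e * (b - a).
Proof.
move=> ab fc fd rc.
have key (k : R) (g : R) (kg : k = 1 \/ k = -1) :
    (forall t, a <= t < b -> t \notin D -> 0 <= k * rho t - g) ->
    k * f a - g * a <= k * f b - g * b.
  move=> H.
  apply: (@right_derivative_mono _ a b (fun x => k * f x - g * x) D) => //.
    move=> t tab; apply: cvgB; first by apply: cvgM; [exact: cvg_cst|exact: fc].
    apply: cvgM; first exact: cvg_cst.
    by apply: cvg_within_filter; exact: cvg_id.
  move=> t tab tD; exists (k * rho t - g); first exact: H.
  have : k * ((f (t + h) - f t) / h) - g @[h --> 0^'+] --> k * rho t - g.
    apply: cvgB; last exact: cvg_cst.
    by apply: cvgM; [exact: cvg_cst|exact: fd].
  apply: cvg_trans; apply: near_eq_cvg; near=> h.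
  have h0 : h != 0 by rewrite gt_eqF//; near: h; exact: nbhs_right_gt.
  by field.
have := key (-1) (- (c + e)) (or_intror erefl); have := key 1 (c - e) (or_introl erefl).
move=> H1 H2.
rewrite ler_norml; apply/andP; split.
  have : 1 * f a - (c - e) * a <= 1 * f b - (c - e) * b; last by lra.
  apply: H1 => t tab tD; have := rc _ tab tD; rewrite ler_norml => /andP[]; lra.
have : -1 * f a - - (c + e) * a <= -1 * f b - - (c + e) * b; last by lra.
apply: H2 => t tab tD; have := rc _ tab tD; rewrite ler_norml => /andP[]; lra.
Unshelve. all: end_near. Qed.

(** The mean value inequality is used on [[t, t + h]], and on [[t + h, t]] for negative [h]: the
    left derivative at [t] comes from the right derivatives at earlier points, which are close to
    [rho t]. *)
Lemma right_derivative_is_derive (R : realType) (a b : R) (f rho : R -> R)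
    (D : seq R) (t : R) :
  (forall t, a <= t <= b -> f x @[x --> within `[a, b] (nbhs t)] --> f t) ->
  (forall t, a <= t < b -> t \notin D ->
     (f (t + h) - f t) / h @[h --> 0^'+] --> rho t) ->
  a < t < b -> rho x @[x --> nbhs t] --> rho t ->
  is_derive t 1 f (rho t).
Proof.
move=> fc fd atb rc.
suff H : h^-1 *: ((f \o shift t) (h *: 1) - f t) @[h --> 0^'] --> rho t.
  by split; [apply/cvg_ex; exists (rho t)|exact: cvg_lim].
apply/cvgrPdist_le => e e0.
have [r /= r0 Hr] : \forall x \near t, `|rho t - rho x| <= e.
  exact: cvgr_dist_le rc _ e0.
have [at_ tb] := andP atb.
near=> h => /=.
have h0 : h != 0 by near: h; exact: nbhs_dnbhs_neq.
have : `|f (h *: 1 + t) - f t - rho t * h| <= e * `|h|.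
  rewrite [h *: 1]mulr1 [h + t]addrC.
  have hr : `|h| < r by near: h; exact: dnbhs0_lt.
  have ha : `|h| < t - a by near: h; apply: dnbhs0_lt; rewrite subr_gt0.
  have hb : `|h| < b - t by near: h; apply: dnbhs0_lt; rewrite subr_gt0.
  have bound x y : a < x -> x <= y -> y < b -> t - r < x -> y < t + r ->
      `|f y - f x - rho t * (y - x)| <= e * (y - x).
    move=> ax xy yb rx yr.
    apply: (@right_derivative_bound _ x y f rho D) => //.
    - move=> u /andP[xu uy]; apply: cvg_withinS; last first.
        by apply: (fc u); rewrite (le_trans (ltW ax) xu) (le_trans uy (ltW yb)).
      by apply: subset_itvcc; exact: ltW.
    - move=> u /andP[xu uy] uD; apply: fd => //.
      by rewrite (le_trans (ltW ax) xu) (lt_trans uy yb).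
    - move=> u /andP[xu uy] uD; rewrite distrC; apply: Hr => /=.
      rewrite ltr_norml; lra.
  move: h0 ha hb hr; rewrite neq_lt => /orP[h0|h0].
    rewrite ltr0_norm// => ha hb hr.
    have := bound (t + h) t; rewrite -normrN.
    have -> : - (f t - f (t + h) - rho t * (t - (t + h))) = f (t + h) - f t - rho t * h by lra.
    have -> : t - (t + h) = - h by lra.
    apply; lra.
  rewrite gtr0_norm// => ha hb hr.
  have := bound t (t + h).
  have -> : t + h - t = h by lra.
  apply; lra.
rewrite -ler_pdivrMr ?normr_gt0// -normf_div distrC.
congr (_ <= _); congr `|_|; rewrite /= [_^-1 *: _]mulrC.
by field.
Unshelve. all: end_near. Qed.

(** * Solutions of the survival equations *)

Lemma cvg_continuous_on (R : realType) (T t : R) (f : R -> R) :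
  0 < t < T -> continuous_on_at T f t -> f x @[x --> t] --> f t.
Proof.
move=> tT; apply: cvg_trans; apply: cvg_app; exact: nbhs_within_itv.
Qed.

Lemma continuous_on_atS (R : realType) (a T t : R) (f : R -> R) :
  a <= T -> continuous_on_at T f t -> continuous_on_at a f t.
Proof. by move=> aT; apply: cvg_withinS; exact: subset_itvcc. Qed.

Lemma continuous_on_eq (R : realType) (T t : R) (f g : R -> R) :
  {near t, f =1 g} -> continuous_on_at T f t -> continuous_on_at T g t.
Proof.
move=> fg; rewrite /continuous_on_at (nbhs_singleton fg).
apply: cvg_trans; apply: near_eq_cvg.
by apply: cvg_within fg.
Qed.

Lemma admissible_regular (R : realType) (T : R) (s : promotion R) :
  admissible T s -> exists D : seq R,
    forall t, 0 <= t <= T -> t \notin D -> regular_time T s t.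
Proof.
move=> [[[[Dp HDp] _ _] _] [[[Dq HDq] _ _] _]].
exists (Dp ++ Dq) => t tT; rewrite mem_cat negb_or => /andP[tp tq].
by split; [exact: HDp|exact: HDq].
Qed.

Lemma outflow_ge0 (R : realType) (M : nat) (p : 'I_M -> R -> R)
    (q : 'I_M -> 'I_M -> R -> R) (u v : R) (W : {set 'I_M}) :
  (forall j, influence_rate (p j)) -> (forall k j, influence_rate (q k j)) ->
  0 <= u -> 0 <= v -> 0 <= outflow p q u v W.
Proof.
move=> hp hq u0 v0; rewrite /outflow /p_set /q_set addr_ge0//.
  by apply: sumr_ge0 => j _; have [+ _ _] := hp j; apply.
apply: sumr_ge0 => k _; apply: sumr_ge0 => j _.
by have [+ _ _] := hq k j; apply.
Qed.

(* Downward induction on [W]: the equation of [S W] involves only larger sets,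
   so the difference [z] of two solutions satisfies [z' = - outflow * z] and
   its square is nonincreasing. *)
Lemma S_solution_unique (R : realType) (M : nat) (p : 'I_M -> R -> R)
    (q : 'I_M -> 'I_M -> R -> R) (T a : R) (s1 s2 : promotion R)
    (S1 S2 : {set 'I_M} -> R -> R) :
  (forall j, influence_rate (p j)) -> (forall k j, influence_rate (q k j)) ->
  a <= T -> admissible T s1 -> admissible T s2 ->
  (forall t, 0 <= t < a -> s_p s1 t = s_p s2 t /\ s_q s1 t = s_q s2 t) ->
  S_solution p q T s1 S1 -> S_solution p q T s2 S2 ->
  forall W, W != finset.set0 -> forall t, 0 <= t <= a -> S1 W t = S2 W t.
Proof.
move=> hp hq aT adm1 adm2 s12 sol1 sol2 W.
have [D1 reg1] := admissible_regular adm1.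
have [D2 reg2] := admissible_regular adm2.
have [n] := ubnP #|(~: W)%SET|; elim: n W => // n IH W Wn W0 t /andP[t0 ta].
have [c1 i1 d1] := sol1 W W0; have [c2 i2 d2] := sol2 W W0.
pose z : R -> R := S1 W - S2 W.
have z_ x : z x = S1 W x - S2 W x by [].
suff : - (z 0 * z 0) <= - (z t * z t).
  rewrite (z_ 0) i1 i2 subrr mulr0 oppr0 oppr_ge0 -expr2 => H.
  by apply/eqP; rewrite -subr_eq0 -z_ -sqrf_eq0 eq_le H sqr_ge0.
apply: (@derive_mono _ _ _ (- (z * z)) (D1 ++ D2)) => //.
  move=> x /andP[x0 xt]; have xT : 0 <= x <= T by rewrite x0 (le_trans xt (le_trans ta aT)).
  have cz : z y @[y --> within `[0, t] (nbhs x)] --> z x.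
    have tT := le_trans ta aT.
    by apply: cvgB; apply: (continuous_on_atS tT); [exact: c1|exact: c2].
  by apply: cvgN; apply: cvgM.
move=> x /andP[x0 xt]; rewrite mem_cat negb_or => /andP[xD1 xD2].
have xT : x < T by rewrite (lt_le_trans xt (le_trans ta aT)).
have xa : x < a := lt_le_trans xt ta.
have xT' : 0 <= x <= T by rewrite !ltW.
have Dz1 := d1 x (introT andP (conj x0 xT)) (reg1 x xT' xD1).
have Dz2 := d2 x (introT andP (conj x0 xT)) (reg2 x xT' xD2).
have [up uq] := s12 x (introT andP (conj (ltW x0) xa)).
have o0 : 0 <= outflow p q (s_p s1 x) (s_q s1 x) W.
  have [[_ pp] [_ qq]] := adm1; apply: outflow_ge0; [by []|by []|exact: pp|exact: qq].
exists (2 * outflow p q (s_p s1 x) (s_q s1 x) W * (z x * z x)).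
  by rewrite -expr2 mulr_ge0 ?sqr_ge0// mulr_ge0.
have Dz : is_derive x 1 z (- outflow p q (s_p s1 x) (s_q s1 x) W * z x).
  apply: is_derive_eq.
  rewrite /S_rhs -up -uq z_.
  have -> : \sum_(k in (~: W)%SET) q_set q k W (s_q s1 x) * S1 (k |: W)%SET x =
            \sum_(k in (~: W)%SET) q_set q k W (s_q s1 x) * S2 (k |: W)%SET x.
    apply: eq_bigr => k; rewrite inE => kW; congr (_ * _); apply: IH.
    - rewrite ltnS in Wn; apply: leq_trans Wn; apply: proper_card.
      by rewrite properC properE finset.subsetUr finset.subUset finset.sub1set (negbTE kW).
    - by apply/set0Pn; exists k; rewrite !inE eqxx.
    - by rewrite !ltW.
  lra.
apply: is_derive_eq.
rewrite /GRing.scale/=; lra.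
Qed.

Lemma cvg_sumr (R : realType) (I : Type) (r : seq I) (Q : pred I) (U : Type)
    (F : set_system U) {FF : Filter F} (f : I -> U -> R) (l : I -> R) :
  (forall i, Q i -> f i x @[x --> F] --> l i) ->
  \sum_(i <- r | Q i) f i x @[x --> F] --> \sum_(i <- r | Q i) l i.
Proof.
by move=> fl; apply: cvg_big => //; exact: add_continuous.
Qed.

(** The rates are continuous only within the nonnegative half-line, so limits at zero spending are
    taken along nonnegative values. *)
Lemma influence_rate_cvg (R : realType) (r g : R -> R) (F : set_system R)
    {FF : Filter F} (l : R) :
  influence_rate r -> 0 <= l -> (\forall x \near F, 0 <= g x) ->
  g x @[x --> F] --> l -> r (g x) @[x --> F] --> r l.
Proof.
move=> [_ /subspace_continuousP rc _] l0 g0 gl.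
apply: (@cvg_comp _ _ _ g r F _ _ _ (rc l _)); last by rewrite /= in_itv/= l0.
move=> A; rewrite /within/= => HA.
have := gl _ HA; rewrite /= /nbhs/= => H.
near=> x.
have gA : [set` `[0, +oo[] (g x) -> A (g x) by near: x; exact: H.
by apply: gA; rewrite /= in_itv/= andbT; near: x.
Unshelve. all: end_near. Qed.

Lemma S_rhs_cvg (R : realType) (M : nat) (p : 'I_M -> R -> R)
    (q : 'I_M -> 'I_M -> R -> R) (F : set_system R) {FF : Filter F}
    (u v : R -> R) (x : {set 'I_M} -> R -> R) (u0 v0 : R) (x0 : {set 'I_M} -> R) :
  (forall j, influence_rate (p j)) -> (forall k j, influence_rate (q k j)) ->
  0 <= u0 -> (\forall t \near F, 0 <= u t) -> u t @[t --> F] --> u0 ->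
  0 <= v0 -> (\forall t \near F, 0 <= v t) -> v t @[t --> F] --> v0 ->
  (forall W, W != finset.set0 -> x W t @[t --> F] --> x0 W) ->
  forall W, W != finset.set0 ->
  S_rhs p q (u t) (v t) (x ^~ t) W @[t --> F] --> S_rhs p q u0 v0 x0 W.
Proof.
move=> hp hq u0ge uge ucv v0ge vge vcv xcv W W0.
have qcv (k : 'I_M) : q_set q k W (v t) @[t --> F] --> q_set q k W v0.
  by apply: cvg_sumr => j _; apply: influence_rate_cvg.
apply: cvgD; [apply: cvgM; last exact: xcv|].
  apply: cvgN; apply: cvgD; last by apply: cvg_sumr => k _.
  by apply: cvg_sumr => j _; apply: influence_rate_cvg.
apply: cvg_sumr => k _; apply: cvgM => //; apply: xcv.
by apply/set0Pn; exists k; rewrite !inE eqxx.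
Qed.

(** * Survival probabilities of the Bass process *)

Section FiniteValuedLaw.
Context (R : realType) d (Om : measurableType d) (P : probability Om R).

Definition pr (E : set Om) : R := fine (P E).

Lemma pr_ge0 (E : set Om) : 0 <= pr E.
Proof. by rewrite fine_ge0. Qed.

(** Reduces relations between probabilities of events about the adopters to pointwise relations
    between indicators on a finite set. *)
Lemma pr_finite (F : finType) (f : Om -> F) (c : pred F) :
  (forall x, measurable (f @^-1` [set x])) ->
  pr [set w | c (f w)] = \sum_x (c x)%:R * pr (f @^-1` [set x]).
Proof.
move=> mf.
have -> : [set w | c (f w)] = \bigcup_(x in [set` c]) (f @^-1` [set x]).
  apply/seteqP; split => w /=; first by move=> cw; exists (f w).
  by move=> [x cx ->].
rewrite /pr measure_fin_bigcup//; last first.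
  by move=> x y _ _ [w [/= fx fy]]; rewrite -fx -fy.
rewrite fsbig_finite//= -sum_fine; last first.
  by move=> x _; rewrite fin_num_measure.
have Hp : perm_eq (finmap.enum_fset (fset_set [set` c])) [seq x <- index_enum F | c x].
  apply: uniq_perm; rewrite ?filter_uniq ?index_enum_uniq ?finmap.fset_uniq//.
  move=> x; rewrite mem_filter mem_index_enum andbT.
  by rewrite in_fset_set//; apply/idP/idP; rewrite inE.
rewrite (perm_big _ Hp) big_filter.
by rewrite big_mkcond/=; apply: eq_bigr => x _; case: (c x); rewrite ?mul1r ?mul0r.
Qed.

End FiniteValuedLaw.

(* With [n] the cardinal of [W :&: B], this is [n - n (n - 1) <= (0 < n) <= n]. *)
Lemma bonferroni (R : realType) (I : finType) (W B : {set I}) :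
  (\sum_(j in W) (j \in B)%:R -
   \sum_(j in W) \sum_(i in W | i != j) ((i \in B) && (j \in B))%:R : R)
  <= (~~ [disjoint W & B]%B)%:R <= (\sum_(j in W) (j \in B)%:R : R).
Proof.
have [WB|/pred0Pn[k /andP[/= kW kB]]] := boolP [disjoint W & B]%B.
  have jB j : j \in W -> (j \in B) = false by move=> jW; rewrite (disjointFr WB jW).
  rewrite (@big1 _ _ _ _ _ _ (fun j => (j \in B)%:R)); last by move=> j /jB ->.
  by rewrite lexx andbT sub0r oppr_le0; do 2![apply: sumr_ge0 => ? _].
apply/andP; split; last by rewrite (bigD1 k)//= kB lerDl sumr_ge0.
rewrite -sumrB (bigD1 k)//= kB -[leRHS]addr0 lerD//.
  by rewrite gerBl; apply: sumr_ge0.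
apply: sumr_le0 => j /andP[jW jk]; rewrite subr_le0.
rewrite (bigD1 k)/=; last by rewrite kW eq_sym.
by rewrite kB/= lerDl sumr_ge0.
Qed.

Section BassLaw.
Context (R : realType) (M : nat) (p : 'I_M -> R -> R) (q : 'I_M -> 'I_M -> R -> R).
Context d (Om : measurableType d) (P : probability Om R).
Context (X : 'I_M -> R -> Om -> bool) (T : R) (s : promotion R).
Context (bass : bass_process p q P X T s).

Definition survival (W : {set 'I_M}) (t : R) : R :=
  pr P [set w | [disjoint W & adopters X t w]%B].

Local Notation sets := {set 'I_M}.
Local Notation ad := (adopters X).
(** Joint law of the adopter sets at two times: events at [t] and at [t'] become sums against the
    same weights, to be subtracted term by term. *)
Let nu (t t' : R) (x : {set 'I_M} * {set 'I_M}) : R :=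
  pr P ((fun w => (ad t w, ad t' w)) @^-1` [set x]).

Let nu_ge0 t t' x : 0 <= nu t t' x.
Proof. exact: pr_ge0. Qed.

Lemma measurable_adopters (t : R) (A : {set 'I_M}) : 0 <= t <= T ->
  measurable [set w | adopters X t w = A].
Proof.
move=> tT.
have -> : [set w | adopters X t w = A] =
    \bigcap_(j in [set: 'I_M]) (X j t @^-1` [set (j \in A)]).
  apply/seteqP; split => w /=.
    by move=> <- j _ /=; rewrite inE.
  by move=> H; apply/finset.setP => j; rewrite inE; exact: H.
apply: fin_bigcap_measurable => // j _.
rewrite -[X in measurable X]setTI.
exact: (bass_measurable bass j tT).
Qed.

Let prE2 t t' (c : pred ({set 'I_M} * {set 'I_M})) :
  0 <= t <= T -> 0 <= t' <= T ->
  pr P [set w | c (ad t w, ad t' w)] = \sum_x (c x)%:R * nu t t' x.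
Proof.
move=> tT tT'; rewrite (pr_finite P (f := fun w => (ad t w, ad t' w)))//.
move=> [A B].
have -> : (fun w => (ad t w, ad t' w)) @^-1` [set (A, B)] =
    [set w | adopters X t w = A] `&` [set w | adopters X t' w = B].
  by apply/seteqP; split => w /=; [case|case=> <- <-].
by apply: measurableI; exact: measurable_adopters.
Qed.

Let prE t (c : pred {set 'I_M}) : 0 <= t <= T ->
  pr P [set w | c (ad t w)] = \sum_(A : sets) (c A)%:R * pr P [set w | ad t w = A].
Proof.
move=> tT; rewrite (pr_finite P (f := ad t))// => A.
exact: measurable_adopters.
Qed.

(** Adoption is irreversible only almost surely, hence the form of the statement. For [A] of
    positive probability, a conditional probability equal to one says that the masses of the pairs
    [(A, B)] with [j] outside [B] sum to zero, and they are nonnegative. *)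
Lemma adopters_monotone (t t' : R) (x : {set 'I_M} * {set 'I_M}) :
  0 <= t -> t <= t' -> t' <= T -> ~~ (x.1 \subset x.2) -> nu t t' x = 0.
Proof.
move=> t0 tt' t'T; case: x => A B /= /fintype.subsetPn[j jA jB].
have tT : 0 <= t <= T by rewrite t0 (le_trans tt').
have tT' : 0 <= t' <= T by rewrite t'T (le_trans t0).
have piE : pr P [set w | ad t w = A] = \sum_(x : sets * sets) (x.1 == A)%:R * nu t t' x.
  rewrite -(prE2 (fun x : sets * sets => x.1 == A))//; congr (pr P _).
  by apply/seteqP; split => w /= => [->//|/eqP].
(* The law is silent about an [A] of probability zero, but all pairs starting with such an [A] are
   null. *)
have [P0|PA] := eqVneq (P [set w | adopters X t w = A]) 0%E.
  move: piE; rewrite /pr P0 /= => /esym/eqP.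
  rewrite psumr_eq0; last by move=> x _; rewrite mulr_ge0.
  move=> /allP/(_ (A, B)); rewrite mem_index_enum/= eqxx mul1r => /(_ isT) /eqP.
  exact.
have := bass_adopter bass t0 tt' t'T PA jA; rewrite /cond_prob => /eqP.
have piA0 : fine (P [set w | adopters X t w = A]) != 0.
  by rewrite fine_eq0// fin_num_measure//; exact: measurable_adopters.
have -> : fine (P ([set w | X j t' w] `&` [set w | adopters X t w = A])) =
    \sum_(x : sets * sets) ((x.1 == A) && (j \in x.2))%:R * nu t t' x.
  rewrite -(prE2 (fun x : sets * sets => (x.1 == A) && (j \in x.2)))//.
  congr (pr P _); apply/seteqP; split => w /=.
    by case=> Xj ->; rewrite eqxx inE.
  by rewrite inE => /andP[/eqP].
rewrite -[_ / _ == 1](can_eq (mulfK piA0)) mul1r divfK//.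
rewrite -[fine _]/(pr P [set w | ad t w = A]) piE eq_sym -subr_eq0 -sumrB.
rewrite psumr_eq0; last first.
  move=> x _; rewrite -mulrBl mulr_ge0// subr_ge0 ler_nat.
  by case: (x.1 == A); case: (j \in x.2).
move=> /allP/(_ (A, B)); rewrite mem_index_enum/= eqxx (negbTE jB) mul1r mul0r subr0.
by move=> /(_ isT)/eqP.
Qed.

Lemma survival0 (W : {set 'I_M}) : 0 <= T -> survival W 0 = 1.
Proof.
move=> T0; have tT : (0 : R) <= 0 <= T by rewrite lexx.
have pi0 (A : sets) : A != finset.set0 -> pr P [set w | ad 0 w = A] = 0.
  move=> /set0Pn[j jA]; rewrite /pr.
  have mX : measurable [set w | X j 0 w].
    have := bass_measurable bass j tT measurableT (Y := [set true]).
    by rewrite setTI => /(_ _); apply.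
  rewrite (_ : P _ = 0%E)//; apply/eqP; rewrite eq_le measure_ge0 andbT.
  rewrite -(bass_initial bass j); apply: le_measure; rewrite ?inE//.
    exact: measurable_adopters.
  by move=> w /= Aw; have := jA; rewrite -Aw inE.
have E1 : pr P [set: Om] = 1 by rewrite /pr probability_setT.
have := prE predT tT; rewrite (_ : [set w | predT (ad 0 w)] = [set: Om]); last first.
  by apply/seteqP.
rewrite E1 /survival => ->.
rewrite (prE (fun A => [disjoint W & A]%B) tT); apply: eq_bigr => A _.
have [->|/pi0 ->] := eqVneq A finset.set0; last by rewrite !mulr0.
by rewrite disjoint_sym finset.disjoints_subset finset.sub0set.
Qed.

(** Pointwise on nested pairs, [W] stops being free of adopters only if one of its nodes adopts.
    This union bound transfers the absence of fixed jumps from single nodes to all sets. *)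
Lemma survival_drop (W : {set 'I_M}) (t t' : R) :
  0 <= t -> t <= t' -> t' <= T ->
  0 <= survival W t - survival W t' <=
  \sum_(j in W) (pr P [set w | X j t' w] - pr P [set w | X j t w]).
Proof.
move=> t0 tt' t'T.
have tT : 0 <= t <= T by rewrite t0 (le_trans tt').
have tT' : 0 <= t' <= T by rewrite t'T (le_trans t0).
rewrite /survival (prE2 (fun x : sets * sets => [disjoint W & x.1]%B) tT tT').
rewrite (prE2 (fun x : sets * sets => [disjoint W & x.2]%B) tT tT') -sumrB.
have -> : \sum_(j in W) (pr P [set w | X j t' w] - pr P [set w | X j t w]) =
    \sum_(x : sets * sets)
      \sum_(j in W) ((j \in x.2)%:R - (j \in x.1)%:R) * nu t t' x.
  rewrite exchange_big/=; apply: eq_bigr => j _.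
  have -> : [set w | X j t' w] = [set w | (j \in (ad t w, ad t' w).2)].
    by apply/seteqP; split => w /=; rewrite inE.
  have -> : [set w | X j t w] = [set w | (j \in (ad t w, ad t' w).1)].
    by apply/seteqP; split => w /=; rewrite inE.
  rewrite (prE2 (fun x : sets * sets => j \in x.2) tT tT').
  rewrite (prE2 (fun x : sets * sets => j \in x.1) tT tT') -sumrB.
  by apply: eq_bigr => x _; rewrite mulrBl.
have key (x : sets * sets) : x.1 \subset x.2 ->
    0 <= ([disjoint W & x.1]%B%:R - [disjoint W & x.2]%B%:R : R) <=
    \sum_(j in W) ((j \in x.2)%:R - (j \in x.1)%:R).
  move=> x12.
  have pos j : 0 <= ((j \in x.2)%:R - (j \in x.1)%:R : R).
    rewrite subr_ge0 ler_nat; case: (boolP (j \in x.1)) => // /(fintype.subsetP x12) ->//.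
  case: (boolP [disjoint W & x.2]%B) => [d2|].
    rewrite (disjointWr x12 d2) subrr lexx/=.
    by apply: sumr_ge0.
  rewrite subr0 ler0n /= => /pred0Pn[j /andP[/= jW j2]].
  case: (boolP [disjoint W & x.1]%B) => [d1|_]; last by apply: sumr_ge0.
  rewrite (bigD1 j)//= j2 (disjointFr d1 jW) subr0 lerDl.
  by apply: sumr_ge0.
apply/andP; split.
  apply: sumr_ge0 => x _; rewrite -mulrBl.
  have [x12|/(adopters_monotone t0 tt' t'T) ->] := boolP (x.1 \subset x.2); last by rewrite mulr0.
  by rewrite mulr_ge0//; case/andP: (key x x12).
apply: ler_sum => x _; rewrite -mulrBl -mulr_suml.
have [x12|/(adopters_monotone t0 tt' t'T) ->] := boolP (x.1 \subset x.2); last by rewrite !mulr0.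
by rewrite ler_wpM2r//; case/andP: (key x x12).
Qed.

Lemma survival_continuous (W : {set 'I_M}) (t : R) :
  0 <= t <= T -> continuous_on_at T (survival W) t.
Proof.
move=> tT; rewrite /continuous_on_at; apply/subr_cvg0/norm_cvg0P.
have lim0 : \sum_(j in W) `|pr P [set w | X j t' w] - pr P [set w | X j t w]|
    @[t' --> within `[0, T] (nbhs t)] --> \sum_(j in W) (0 : R).
  apply: (cvg_sumr (l := fun=> 0)) => j _.
  rewrite -[X in _ --> X](normr0 R); apply: cvg_norm.
  rewrite -[X in _ --> X](subrr (pr P [set w | X j t w])); apply: cvgB; last exact: cvg_cst.
  exact: (bass_no_fixed_jump bass).
rewrite big1// in lim0.
apply: (squeeze_cvgr _ (cvg_cst 0) lim0).
near=> t'.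
have t'T : 0 <= t' <= T.
  suff : [set` `[0, T]] t' by rewrite /= in_itv.
  by near: t'; exact: withinT.
rewrite normr_ge0/=.
have bnd a b : 0 <= a <= T -> 0 <= b <= T -> a <= b ->
    `|survival W a - survival W b| <=
    \sum_(j in W) `|pr P [set w | X j b w] - pr P [set w | X j a w]|.
  move=> /andP[a0 _] /andP[_ bT] ab; have /andP[d0 d1] := survival_drop W a0 ab bT.
  rewrite ger0_norm// (le_trans d1)//; apply: ler_sum => j _.
  exact: ler_norm.
have [tt'|/ltW tt'] := leP t t'; first by rewrite distrC; exact: bnd.
by under eq_bigr do rewrite distrC; exact: bnd.
Unshelve. all: end_near. Qed.

(** The two Bonferroni bounds differ by the pair terms, which are [o(h)] by [bass_simple], while the
    single-node terms have the prescribed rates; the quotient is squeezed. *)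
Lemma first_adoption_rate (W A : {set 'I_M}) (t : R) :
  0 <= t < T -> regular_time T s t -> [disjoint W & A]%B ->
  pr P [set w | ad t w = A /\ ~~ [disjoint W & ad (t + h) w]%B] / h
    @[h --> 0^'+] -->
  pr P [set w | ad t w = A] *
    \sum_(j in W) adoption_rate p q (s_p s t) (s_q s t) A j.
Proof.
move=> tT reg dWA; have /andP[t0 tltT] := tT.
have tTc : 0 <= t <= T by rewrite t0 ltW.
pose F1 (j : 'I_M) (h : R) := pr P [set w | ad t w = A /\ j \in ad (t + h) w].
pose F2 (i j : 'I_M) (h : R) :=
  pr P [set w | ad t w = A /\ (i \in ad (t + h) w) && (j \in ad (t + h) w)].
have nA j : j \in W -> j \notin A by move=> jW; rewrite (disjointFr dWA jW).
have condE (E : set Om) : P [set w | ad t w = A] != 0%E ->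
    fine (P (E `&` [set w | ad t w = A])) =
    pr P [set w | ad t w = A] * cond_prob P E [set w | ad t w = A].
  move=> PA; rewrite /cond_prob mulrC divfK//.
  by rewrite fine_eq0// fin_num_measure//; exact: measurable_adopters.
(* The law conditions on adopter sets of positive probability only; for the others both the
   quotients and the claimed limits are zero. *)
have null (h : R) (c : pred sets) : 0 < h -> t + h <= T ->
    P [set w | ad t w = A] = 0%E ->
    pr P [set w | ad t w = A /\ c (ad (t + h) w)] = 0.
  move=> h0 hT PA; rewrite /pr; suff -> : P [set w | ad t w = A /\ c (ad (t + h) w)] = 0%E by [].
  apply/eqP; rewrite eq_le measure_ge0 andbT -PA; apply: le_measure.
  - rewrite inE.
    have -> : [set w | ad t w = A /\ c (ad (t + h) w)] =
       \bigcup_(B in [set` c]) ([set w | ad t w = A] `&` [set w | ad (t + h) w = B]).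
      apply/seteqP; split => w /=; first by case=> wA wc; exists (ad (t + h) w).
      by case=> B /= cB [-> ->].
    apply: fin_bigcup_measurable => // B _.
    apply: measurableI; apply: measurable_adopters => //.
    by apply/andP; split=> //; rewrite addr_ge0// ltW.
  - by rewrite inE; exact: measurable_adopters.
  - by move=> w [].
have near_hT : \forall h \near (0 : R)^'+, t + h <= T.
  near=> h; rewrite -lerBrDl; near: h; apply: nbhs_right_le; rewrite subr_gt0//.
have F1cv j : j \in W -> F1 j h / h @[h --> 0^'+] -->
    pr P [set w | ad t w = A] * adoption_rate p q (s_p s t) (s_q s t) A j.
  move=> jW; have [PA|PA] := eqVneq (P [set w | ad t w = A]) 0%E.
    rewrite /pr PA mul0r; apply: cvg_near_cst; near=> h.
    have h0 : 0 < h by near: h; exact: nbhs_right_gt.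
    have hT : t + h <= T by near: h.
    by rewrite /F1 (null h (fun B => j \in B)) ?mul0r.
  have : pr P [set w | ad t w = A] *
      (cond_prob P [set w | X j (t + h) w] [set w | ad t w = A] / h) @[h --> 0^'+] -->
      pr P [set w | ad t w = A] * adoption_rate p q (s_p s t) (s_q s t) A j.
    by apply: cvgM; [exact: cvg_cst|exact: (bass_nonadopter bass tT reg PA (nA j jW))].
  apply: cvg_trans; apply: near_eq_cvg; near=> h; rewrite /= mulrA -condE//.
  congr (fine (P _) / _); apply/seteqP; split => w /=; rewrite inE; tauto.
have F2cv i j : i \in W -> j \in W -> i != j -> F2 i j h / h @[h --> 0^'+] --> (0 : R).
  move=> iW jW ij; have [PA|PA] := eqVneq (P [set w | ad t w = A]) 0%E.
    apply: cvg_near_cst; near=> h.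
    have h0 : 0 < h by near: h; exact: nbhs_right_gt.
    have hT : t + h <= T by near: h.
    by rewrite /F2 (null h (fun B => (i \in B) && (j \in B))) ?mul0r.
  have : pr P [set w | ad t w = A] *
      (cond_prob P [set w | X i (t + h) w /\ X j (t + h) w] [set w | ad t w = A] / h)
      @[h --> 0^'+] --> pr P [set w | ad t w = A] * 0.
    by apply: cvgM; [exact: cvg_cst|exact: (bass_simple bass tT reg PA (nA i iW) (nA j jW) ij)].
  rewrite mulr0.
  apply: cvg_trans; apply: near_eq_cvg; near=> h; rewrite /= mulrA -condE//.
  congr (fine (P _) / _); apply/seteqP; split => w /=; rewrite !inE.
    by case=> [[-> ->] ->].
  by case=> -> /andP[-> ->].
have bonf (h : R) : 0 < h -> t + h <= T ->
    \sum_(j in W) F1 j h / h - \sum_(j in W) \sum_(i in W | i != j) F2 i j h / h <=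
    pr P [set w | ad t w = A /\ ~~ [disjoint W & ad (t + h) w]%B] / h <=
    \sum_(j in W) F1 j h / h.
  move=> h0 hT; have hTc : 0 <= t + h <= T by rewrite hT addr_ge0// ltW.
  have E (c : pred sets) : pr P [set w | ad t w = A /\ c (ad (t + h) w)] =
      \sum_(x : sets * sets) ((x.1 == A) && c x.2)%:R * nu t (t + h) x.
    rewrite -(prE2 (fun x : sets * sets => (x.1 == A) && c x.2))//.
    congr (pr P _); apply/seteqP; split => w /=; first by case=> -> ->; rewrite eqxx.
    by case/andP=> /eqP.
  have -> : \sum_(j in W) \sum_(i in W | i != j) F2 i j h / h =
     (\sum_(x : sets * sets) (\sum_(j in W) \sum_(i in W | i != j)
        ((x.1 == A) && ((i \in x.2) && (j \in x.2)))%:R) * nu t (t + h) x) / h.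
    rewrite mulr_suml; under [RHS]eq_bigr do rewrite !mulr_suml.
    rewrite exchange_big/=; apply: eq_bigr => j _.
    under [RHS]eq_bigr do rewrite !mulr_suml.
    rewrite exchange_big/=; apply: eq_bigr => i _.
    by rewrite /F2 (E (fun B => (i \in B) && (j \in B))) mulr_suml.
  have -> : \sum_(j in W) F1 j h / h =
     (\sum_(x : sets * sets) (\sum_(j in W) ((x.1 == A) && (j \in x.2))%:R)
        * nu t (t + h) x) / h.
    rewrite mulr_suml; under [RHS]eq_bigr do rewrite !mulr_suml.
    rewrite exchange_big/=; apply: eq_bigr => j _.
    by rewrite /F1 (E (fun B => j \in B)) mulr_suml.
  rewrite (E (fun B => ~~ [disjoint W & B]%B)) -mulrBl -sumrB.
  rewrite !ler_pM2r ?invr_gt0//.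
  apply/andP; split; apply: ler_sum => x _; rewrite -?mulrBl ler_wpM2r//.
    under eq_bigr do rewrite -mulnb natrM.
    under [X in _ - X <= _]eq_bigr do under eq_bigr do rewrite -mulnb natrM.
    under [X in _ - X <= _]eq_bigr do rewrite -mulr_sumr.
    rewrite -!mulr_sumr -mulrBr -mulnb natrM ler_wpM2l//.
    by have /andP[] := bonferroni R W x.2.
  under eq_bigr do rewrite -mulnb natrM.
  rewrite -mulr_sumr -mulnb natrM ler_wpM2l//.
  by have /andP[] := bonferroni R W x.2.
have low : \sum_(j in W) F1 j h / h - \sum_(j in W) \sum_(i in W | i != j) F2 i j h / h
    @[h --> 0^'+] -->
    pr P [set w | ad t w = A] *
    \sum_(j in W) adoption_rate p q (s_p s t) (s_q s t) A j.
  rewrite -[X in _ --> X]subr0; apply: cvgB.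
    by rewrite mulr_sumr; apply: cvg_sumr => j jW; exact: F1cv.
  have sum0 : \sum_(j in W) \sum_(i in W | i != j) (0 : R) = 0.
    by rewrite big1// => j _; rewrite big1.
  rewrite -[X in _ --> X]sum0.
  apply: (cvg_sumr (l := fun j => \sum_(i in W | i != j) 0)) => j jW.
  apply: (cvg_sumr (l := fun i => 0)) => i /andP[iW ij]; exact: F2cv.
apply: (squeeze_cvgr _ low); last first.
  by rewrite mulr_sumr; apply: cvg_sumr => j jW; exact: F1cv.
near=> h; apply: bonf; last by near: h.
by near: h; exact: nbhs_right_gt.
Unshelve. all: end_near. Qed.

Lemma survivalE (W : sets) (t : R) : 0 <= t <= T ->
  survival W t = \sum_(A : sets) [disjoint W & A]%B%:R * pr P [set w | ad t w = A].
Proof. by move=> tT; rewrite /survival (prE (fun A => [disjoint W & A]%B)). Qed.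

(** On nested pairs, disjointness at [t'] implies disjointness at [t], so the difference of the two
    indicators is the product of the earlier one and the negation of the later one. *)
Lemma survival_dropE (W : sets) (t t' : R) : 0 <= t -> t <= t' -> t' <= T ->
  survival W t - survival W t' =
  \sum_(A : sets) [disjoint W & A]%B%:R *
    pr P [set w | ad t w = A /\ ~~ [disjoint W & ad t' w]%B].
Proof.
move=> t0 tt' t'T.
have tT : 0 <= t <= T by rewrite t0 (le_trans tt').
have tT' : 0 <= t' <= T by rewrite t'T (le_trans t0).
rewrite /survival (prE2 (fun x : sets * sets => [disjoint W & x.1]%B) tT tT').
rewrite (prE2 (fun x : sets * sets => [disjoint W & x.2]%B) tT tT') -sumrB.
have E A : pr P [set w | ad t w = A /\ ~~ [disjoint W & ad t' w]%B] =
    \sum_(x : sets * sets) ((x.1 == A) && ~~ [disjoint W & x.2]%B)%:R * nu t t' x.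
  rewrite -(prE2 (fun x : sets * sets => (x.1 == A) && ~~ [disjoint W & x.2]%B))//.
  congr (pr P _); apply/seteqP; split => w /=; first by case=> -> ->; rewrite eqxx.
  by case/andP=> /eqP.
under [RHS]eq_bigr do rewrite E mulr_sumr.
rewrite exchange_big/=; apply: eq_bigr => x _.
rewrite (bigD1 x.1)//= eqxx big1 ?addr0; last first.
  by move=> A /negbTE; rewrite eq_sym => ->; rewrite mul0r mulr0.
have [x12|/(adopters_monotone t0 tt' t'T) ->] := boolP (x.1 \subset x.2); last first.
  by rewrite !mulr0 subrr.
rewrite -mulrBl mulrA; congr (_ * _) => /=.
have [d2|d2] := boolP [disjoint W & x.2]%B; last by rewrite subr0 mulr1.
by rewrite (disjointWr x12 d2) subrr mulr0.
Qed.

(** Here the system closes. For [A] disjoint from [W], the rates over [W] sum to [p_set] plus the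
    [q_set] of each [k] in [A]; replacing the indicator of [k \in A] by one minus that of
    [k \notin A] produces the event that [k |: W] is free of adopters. *)
Lemma survival_rhs (W : sets) (t u v : R) : 0 <= t <= T ->
  S_rhs p q u v (survival ^~ t) W =
  - \sum_(A : sets) [disjoint W & A]%B%:R *
    (pr P [set w | ad t w = A] * \sum_(j in W) adoption_rate p q u v A j).
Proof.
move=> tT.
have rateE (A : sets) : [disjoint W & A]%B ->
    \sum_(j in W) adoption_rate p q u v A j =
    p_set p W u + \sum_(k in (~: W)%SET) q_set q k W v * (k \in A)%:R.
  move=> dWA; rewrite /adoption_rate big_split/=; congr (_ + _).
  rewrite exchange_big/= [RHS]big_mkcond/=; apply: eq_bigr => k _.
  rewrite inE; case: (boolP (k \in W)) => kW /=.
    by rewrite big1// => j _; rewrite (disjointFr dWA kW) mulr0.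
  by rewrite /q_set mulr_suml.
rewrite /S_rhs /outflow survivalE//.
have -> : \sum_(k in (~: W)%SET) q_set q k W v * survival (k |: W)%SET t =
  \sum_(A : sets) pr P [set w | ad t w = A] *
    \sum_(k in (~: W)%SET) q_set q k W v * [disjoint (k |: W)%SET & A]%B%:R.
  under [RHS]eq_bigr do rewrite mulr_sumr.
  rewrite exchange_big/=; apply: eq_bigr => k _.
  by rewrite survivalE// mulr_sumr; apply: eq_bigr => A _; ring.
rewrite mulr_sumr -big_split/= -sumrN; apply: eq_bigr => A _.
have [dWA|dWA] := boolP [disjoint W & A]%B; last first.
  rewrite [X in _ + _ * X]big1 ?mul0r ?mulr0 ?addr0 ?oppr0// => k _.
  suff -> : [disjoint (k |: W)%SET & A]%B = false by rewrite mulr0.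
  apply: contraNF dWA; apply: disjointWl; exact: finset.subsetUr.
rewrite rateE//.
have -> : \sum_(k in (~: W)%SET) q_set q k W v * [disjoint (k |: W)%SET & A]%B%:R =
   \sum_(k in (~: W)%SET) q_set q k W v -
   \sum_(k in (~: W)%SET) q_set q k W v * (k \in A)%:R.
  rewrite -sumrB; apply: eq_bigr => k _.
  have -> : [disjoint (k |: W)%SET & A]%B = (k \notin A).
    rewrite finset.disjoints_subset finset.subUset -(finset.disjoints_subset W).
    by rewrite dWA andbT finset.sub1set inE.
  by case: (k \in A); rewrite /= ?mulr1 ?mulr0 ?subrr ?subr0.
rewrite !mul1r; ring.
Qed.

Lemma survival_right_derivative (W : sets) (t : R) :
  0 <= t < T -> regular_time T s t ->
  (survival W (t + h) - survival W t) / h @[h --> 0^'+] -->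
  S_rhs p q (s_p s t) (s_q s t) (survival ^~ t) W.
Proof.
move=> tT reg; have /andP[t0 tltT] := tT.
have tTc : 0 <= t <= T by rewrite t0 ltW.
rewrite survival_rhs//.
have : - \sum_(A : sets) [disjoint W & A]%B%:R *
     (pr P [set w | ad t w = A /\ ~~ [disjoint W & ad (t + h) w]%B] / h)
   @[h --> 0^'+] -->
   - \sum_(A : sets) [disjoint W & A]%B%:R *
    (pr P [set w | ad t w = A] * \sum_(j in W) adoption_rate p q (s_p s t) (s_q s t) A j).
  apply: cvgN; apply: cvg_sumr => A _.
  have [dWA|_] := boolP [disjoint W & A]%B; last first.
    by rewrite mul0r; apply: cvg_near_cst; near=> h; rewrite mul0r.
  by apply: cvgM; [exact: cvg_cst|exact: first_adoption_rate].
apply: cvg_trans; apply: near_eq_cvg; near=> h.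
have h0 : 0 < h by near: h; exact: nbhs_right_gt.
have hT : t + h <= T.
  by rewrite -lerBrDl; near: h; apply: nbhs_right_le; rewrite subr_gt0.
rewrite -opprB survival_dropE ?lerDl ?(ltW h0)// mulNr mulr_suml.
by congr (- _); apply: eq_bigr => A _; rewrite mulrA.
Unshelve. all: end_near. Qed.

End BassLaw.

(** * The profit as a primitive *)

Lemma notin_near (R : realType) (E : seq R) (t : R) :
  t \notin E -> \forall x \near t, x \notin E.
Proof.
elim: E => [|e E IH]; first by move=> _; near=> x.
rewrite inE negb_or neq_lt => /andP[te /IH tE].
have ne : \forall x \near t, x != e.
  case/orP: te => [te|et].
    by near=> x; rewrite lt_eqF//; near: x; exact: lt_nbhsl.
  by near=> x; rewrite gt_eqF//; near: x; exact: lt_nbhsr.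
near=> x; rewrite inE negb_or; apply/andP; split; near: x => //.
Unshelve. all: end_near. Qed.

(** Continuity gives measurability on the open set [U]; the endpoints and the exceptional times are
    then added one at a time, whatever the values of [f] there. *)
Lemma measurable_off_finite (R : realType) (T : R) (E : seq R) (f : R -> R) :
  (forall t, 0 < t < T -> t \notin E -> f x @[x --> t] --> f t) ->
  measurable_fun `[0, T] f.
Proof.
move=> fc.
pose U : set R := [set t | 0 < t < T /\ t \notin E].
have oU : open U.
  rewrite openE => t [/andP[t0 tT] tE]; rewrite /interior.
  near=> x; split; last by near: x; exact: notin_near.
  by apply/andP; split; near: x; [exact: lt_nbhsr|exact: lt_nbhsl].
have mU : measurable_fun U f.
  apply: measurable_realfun.open_continuous_measurable_fun => // t.
  by rewrite inE => -[tT tE]; exact: fc.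
suff mUE (l : seq R) : measurable_fun (U `|` [set` l]) f /\ measurable [set` l].
  have [mf ml] := mUE (0 :: T :: E).
  apply: measurable_funS mf => //.
    by apply: measurableU => //; exact: measurable_realfun.open_measurable.
  move=> t /=; rewrite in_itv/= => /andP[t0 tT].
  have [tl|] := boolP (t \in [:: 0, T & E]); first by right.
  rewrite !inE !negb_or => /and3P[nt0 ntT ntE]; left.
  by split => //; rewrite !lt_neqAle eq_sym nt0 t0 ntT tT.
elim: l => [|e l [IHf IHl]].
  rewrite (_ : [set` [::]] = set0) ?setU0; last by apply/seteqP; split.
  by split.
have -> : [set` e :: l] = [set e] `|` [set` l].
  apply/seteqP; split => x /=; rewrite inE.
    by case/orP => [/eqP|]; [left|right].
  by case=> [->|->]; rewrite ?eqxx ?orbT.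
split; last by apply: measurableU.
rewrite setUCA; apply/measurable_funU => //.
  by apply: measurableU => //; exact: measurable_realfun.open_measurable.
by split => //; exact: measurable_fun_set1.
Unshelve. all: end_near. Qed.

(** [f] stands for the integrand as written in the profit, uncontrolled at the exceptional times,
    and [g] for its explicit form, whose continuity and bound are within reach. *)
Lemma integral_primitive (R : realType) (T B : R) (E : seq R) (f g : R -> R) :
  0 < T ->
  (forall t, 0 < t < T -> t \notin E -> f t = g t) ->
  (forall t, 0 < t < T -> t \notin E -> g x @[x --> t] --> g t) ->
  (forall t, 0 < t < T -> t \notin E -> `|g t| <= B) ->
  exists J : R -> R, [/\ J 0 = 0,
    J T = \int[lebesgue_measure]_(t in `[0, T]) f t,
    forall t, 0 <= t <= T -> continuous_on_at T J t &
    forall t, 0 < t < T -> t \notin E -> is_derive t 1 J (g t)].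
Proof.
move=> T0 fg gc gB.
have fc t : 0 < t < T -> t \notin E -> f x @[x --> t] --> f t.
  move=> tT tE; rewrite fg//; apply: cvg_trans (gc t tT tE).
  apply: near_eq_cvg; near=> x; rewrite fg//; near: x; last exact: notin_near.
  move/andP: tT => [t0 tT]; near=> x; apply/andP; split; near: x.
    exact: lt_nbhsr.
  exact: lt_nbhsl.
have intf : lebesgue_measure.-integrable `[0, T] (EFin \o f).
  apply: measurable_bounded_integrable => //.
  - by rewrite /= lebesgue_measure_itv/=; case: ifP => _; rewrite -?EFinD ltry.
  - exact: (measurable_off_finite fc).
  (* The bound is required at every point, so the values of [f] at [0], at [T] and on [E] are added
     to [B]. *)
  - set C := `|B| + \sum_(d <- [:: 0, T & E]) `|f d|.
    have sum0 (l : seq R) : 0 <= \sum_(d <- l) `|f d| by exact: sumr_ge0.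
    exists C; split; first exact: num_real.
    move=> y Cy t /=; rewrite in_itv/= => /andP[t0 tT]; apply: le_trans (ltW Cy).
    have [tl|] := boolP (t \in [:: 0, T & E]).
      rewrite /C (big_rem t)//= addrCA lerDl addr_ge0//; exact: sumr_ge0.
    rewrite !inE !negb_or => /and3P[nt0 ntT ntE].
    have tT' : 0 < t < T by rewrite !lt_neqAle eq_sym nt0 t0 ntT tT.
    by rewrite fg// (le_trans (gB t tT' ntE))// -[leLHS]addr0 lerD ?ler_norm.
exists (fun x => \int[lebesgue_measure]_(t in `[0, x]) f t); split => //.
- by rewrite set_itv1 Rintegral_set1.
- move=> t tT.
  have := parameterized_integral_continuous (ltW T0) intf.
  by move/subspace_continuousP; apply; rewrite /= in_itv.
- move=> t tT tE; have /andP[t0 ltT] := tT.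
  have [] := @continuous_FTC1 R f (BLeft 0) t T ltT intf _ (fc t tT tE).
    exact: t0.
  by move=> dJ; rewrite derive1E fg// => <-; exact/derivableP.
Unshelve. all: end_near. Qed.

Lemma one_sided_limits_bounded (R : realType) (T : R) (g : R -> R) :
  (forall t, 0 <= t < T -> cvg (g x @[x --> t^'+])) ->
  (forall t, 0 < t <= T -> cvg (g x @[x --> t^'-])) ->
  exists B : R, forall t, 0 <= t <= T -> `|g t| <= B.
Proof.
move=> gr gl.
have bnd (F : set_system R) (FF : Filter F) : cvg (g x @[x --> F]) ->
    exists C : R, \forall x \near F, `|g x| <= C.
  move=> /cvg_ex[l gl']; exists (`|l| + 1).
  have : \forall x \near F, `|l - g x| <= 1 by exact: cvgr_dist_le gl' _ ltr01.
  apply: filterS => x; rewrite distrC => xl.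
  by rewrite -(subrK l (g x)) (le_trans (ler_normD _ _))// addrC lerD2l.
have loc t : 0 <= t <= T ->
    exists C : R, \forall x \near t, 0 <= x <= T -> `|g x| <= C.
  move=> /andP[t0 tT].
  have [C1 HC1] : exists C : R, \forall x \near t, t < x -> x <= T -> `|g x| <= C.
    have [ltT|Tt] := ltP t T.
      have [|C HC] := bnd t^'+ _ (gr t _); first by rewrite t0.
      by exists C; near=> x => tx _; move: tx; near: x; exact: HC.
    exists 0; near=> x => tx xT.
    by have := lt_le_trans tx xT; rewrite ltNge Tt.
  have [C2 HC2] : exists C : R, \forall x \near t, x < t -> 0 <= x -> `|g x| <= C.
    have [lt0|t0'] := ltP 0 t.
      have [|C HC] := bnd t^'- _ (gl t _); first by rewrite lt0.
      by exists C; near=> x => tx _; move: tx; near: x; exact: HC.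
    exists 0; near=> x => tx x0.
    by have := le_lt_trans x0 tx; rewrite ltNge t0'.
  exists (`|C1| + `|C2| + `|g t|).
  near=> x => /andP[x0 xT].
  have H1 : t < x -> x <= T -> `|g x| <= C1 by near: x.
  have H2 : x < t -> 0 <= x -> `|g x| <= C2 by near: x.
  have := normr_ge0 (g t); have := normr_ge0 C1; have := normr_ge0 C2.
  have := ler_norm C1; have := ler_norm C2.
  case: (ltgtP x t) => [xt|tx|->]; [have := H2 xt x0|have := H1 tx xT|]; lra.
(* Compactness in near-covering form, with the filter [+oo] on the candidate bounds: what holds
   locally for all large [B] holds on the whole segment for all large [B]. *)
have := @segment_compact R 0 T; rewrite compact_near_coveringP.
move=> /(_ R +oo (fun B x => 0 <= x <= T -> `|g x| <= B)) [].
  move=> t; rewrite /= in_itv/= => /loc[C HC].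
  exists ([set x | 0 <= x <= T -> `|g x| <= C], [set B | C <= B]) => /=.
    by split => //; exists C; split; [exact: num_real|move=> y /ltW].
  by move=> [x B] /= [Hx CB] xT; rewrite (le_trans _ CB)// Hx.
move=> B [_ HB]; exists (B + 1) => t tT.
by apply: (HB (B + 1)); rewrite ?ltrDl//= in_itv.
Unshelve. all: end_near. Qed.

Lemma finset1_neq0 (I : finType) (j : I) : [set j]%SET != finset.set0.
Proof. by apply/set0Pn; exists j; rewrite inE. Qed.

(** The filter is arbitrary so as to include one-sided limits at a jump, where [u0] and [v0] need
    not be the values of the promotion. *)
Lemma hamiltonian_cvg (R : realType) (M : nat) (p : 'I_M -> R -> R)
    (q : 'I_M -> 'I_M -> R -> R) (theta gamma : R)
    (F : set_system R) {FF : Filter F}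
    (u v : R -> R) (x y : {set 'I_M} -> R -> R) (t0 u0 v0 : R)
    (x0 y0 : {set 'I_M} -> R) :
  (forall j, influence_rate (p j)) -> (forall k j, influence_rate (q k j)) ->
  F --> nbhs t0 ->
  0 <= u0 -> (\forall t \near F, 0 <= u t) -> u t @[t --> F] --> u0 ->
  0 <= v0 -> (\forall t \near F, 0 <= v t) -> v t @[t --> F] --> v0 ->
  (forall W, W != finset.set0 -> x W t @[t --> F] --> x0 W) ->
  (forall W, W != finset.set0 -> y W t @[t --> F] --> y0 W) ->
  hamiltonian p q theta gamma t (x ^~ t) (y ^~ t) (u t) (v t) @[t --> F] -->
  hamiltonian p q theta gamma t0 x0 y0 u0 v0.
Proof.
move=> hp hq Ft u0ge uge ucv v0ge vge vcv xcv ycv.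
have Scv W : W != finset.set0 ->
    S_rhs p q (u t) (v t) (x ^~ t) W @[t --> F] --> S_rhs p q u0 v0 x0 W.
  by move=> W0; exact: S_rhs_cvg.
apply: cvgD; last by apply: cvg_sumr => W W0; apply: cvgM; [exact: ycv|exact: Scv].
apply: cvgM.
  apply: cvgB; last exact: cvgD.
  apply: cvgM; first exact: cvg_cst.
  by apply: cvg_sumr => j _; exact/Scv/finset1_neq0.
apply: (cvg_trans (cvg_app _ Ft)).
apply: (@continuous_comp _ _ _ (fun t => - theta * t) expR); last exact: continuous_expR.
by apply: cvgM; [exact: cvg_cst|exact: cvg_id].
Qed.

Lemma spending_near (R : realType) (T t : R) (g : R -> R) (F : set_system R)
    {FF : Filter F} :
  F --> within `[0, T] (nbhs t) -> spending_rate T g -> \forall x \near F, 0 <= g x.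
Proof.
move=> Ft [_ g0]; apply: Ft; near=> x.
apply: g0.
suff : [set` `[0, T]] x by rewrite /= in_itv.
by near: x; exact: withinT.
Unshelve. all: end_near. Qed.

Section ProcessProfit.
Context (R : realType) (M : nat) (p : 'I_M -> R -> R) (q : 'I_M -> 'I_M -> R -> R).
Context (hp : forall j, influence_rate (p j))
  (hq : forall k j, influence_rate (q k j)).
Context d (Om : measurableType d) (P : probability Om R).
Context (X : 'I_M -> R -> Om -> bool) (T : R) (s : promotion R).
Context (T_gt0 : 0 < T) (adm : admissible T s) (bass : bass_process p q P X T s).

Lemma bass_S_solution : S_solution p q T s (survival P X).
Proof.
have [D reg] := admissible_regular adm.
move=> W W0; split.
- by move=> t tT; exact: (survival_continuous bass).
- by apply: (survival0 bass); exact: ltW.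
- move=> t tT regt; have /andP[t0 ltT] := tT.
  have tTc : 0 <= t <= T by rewrite !ltW.
  pose rho t' := S_rhs p q (s_p s t') (s_q s t') (survival P X ^~ t') W.
  apply: (@right_derivative_is_derive _ 0 T _ rho D).
  + by move=> x xT; exact: (survival_continuous bass).
  + move=> x /andP[x0 xT] xD; apply: (survival_right_derivative bass).
      by rewrite x0.
    by apply: reg => //; rewrite x0 ltW.
  + by [].
  + have near_id := nbhs_within_itv tT.
    have [[_ p0] [_ q0]] := adm.
    apply: S_rhs_cvg => //.
    * exact: p0.
    * exact: (spending_near near_id adm.1).
    * exact: (cvg_continuous_on tT regt.1).
    * exact: q0.
    * exact: (spending_near near_id adm.2).
    * exact: (cvg_continuous_on tT regt.2).
    * move=> V _; apply: (cvg_continuous_on tT).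
      exact: (survival_continuous bass).
Qed.

Lemma adoption_levelE (M_gt0 : (0 < M)%N) (t : R) : 0 <= t <= T ->
  adoption_level P X t = 1 - M%:R^-1 * \sum_(j < M) survival P X [set j]%SET t.
Proof.
move=> tT.
have mX j : measurable [set w | X j t w].
  have := bass_measurable bass j tT measurableT (Y := [set true]).
  by rewrite setTI => /(_ _); apply.
have E j : fine ('E_P [fun w => (X j t w)%:R : R])%E = 1 - survival P X [set j]%SET t.
  have -> : (fun w => (X j t w)%:R : R) = \1_[set w | X j t w].
    apply/funext => w; rewrite indicE; congr (_%:R).
    by case: (boolP (X j t w)) => Xj; [rewrite mem_set|rewrite memNset//; exact/negP].
  rewrite expectation_indic// /survival /pr.
  have -> : [set w | [disjoint [set j]%SET & adopters X t w]%B] = ~` [set w | X j t w].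
    apply/seteqP; split => w /=; rewrite finset.disjoints_subset finset.sub1set !inE.
      by move/negP.
    by move/negP.
  rewrite probability_setC// fineB ?fin_num_measure//= opprB addrCA subrr addr0.
  by [].
rewrite /adoption_level (eq_bigr _ (fun j _ => E j)) sumrB mulrBr.
by rewrite sumr_const card_ord mulVf// pnatr_eq0 -lt0n.
Qed.

(** With zero costates the Hamiltonian is the discounted running profit, since the adoption level is
    one minus the mean survival probability of the single nodes. *)
Lemma profit_primitive (M_gt0 : (0 < M)%N) (theta gamma : R) :
  exists (J : R -> R) (E : seq R), [/\ J 0 = 0,
    J T = profit P X T theta gamma s,
    forall t, 0 <= t <= T -> continuous_on_at T J t &
    forall t, 0 < t < T -> t \notin E -> is_derive t 1 J
      (hamiltonian p q theta gamma t (survival P X ^~ t) (fun=> 0)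
        (s_p s t) (s_q s t))].
Proof.
have [D reg] := admissible_regular adm.
pose g t := hamiltonian p q theta gamma t (survival P X ^~ t) (fun=> 0) (s_p s t) (s_q s t).
(* Used twice: with the one-sided limits of [s], for the boundedness of [g], and with its values at
   a regular time, for the continuity of [g]. *)
have gcv (F : set_system R) (FF : Filter F) (t u0 v0 : R) : 0 <= t <= T ->
    F --> within `[0, T] (nbhs t) ->
    0 <= u0 -> 0 <= v0 -> s_p s x @[x --> F] --> u0 -> s_q s x @[x --> F] --> v0 ->
    g x @[x --> F] --> hamiltonian p q theta gamma t (survival P X ^~ t) (fun=> 0) u0 v0.
  move=> tT Ft u0ge v0ge ucv vcv.
  apply: (@hamiltonian_cvg _ _ _ _ _ _ _ _ (s_p s) (s_q s) (survival P X) (fun _ _ => 0)) => //.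
  - by move=> A HA; apply: Ft; exact: cvg_within HA.
  - exact: (spending_near Ft adm.1).
  - exact: (spending_near Ft adm.2).
  - move=> W _; have : continuous_on_at T (survival P X W) t.
      exact: (survival_continuous bass).
    by apply: cvg_trans; exact: cvg_app Ft.
  - by move=> W _; exact: cvg_cst.
have gB : exists B : R, forall t, 0 <= t <= T -> `|g t| <= B.
  have [[pcp p0] [pcq q0]] := adm.
  apply: one_sided_limits_bounded => t /andP[t0 tT].
    have Ft : t^'+ --> within `[0, T] (nbhs t) by apply: at_right_within; rewrite t0.
    have [_ /(_ t) + _] := pcp; rewrite t0 tT => /(_ isT) /cvg_ex[u0 ucv].
    have [_ /(_ t) + _] := pcq; rewrite t0 tT => /(_ isT) /cvg_ex[v0 vcv].
    apply/cvg_ex; eexists; apply: (gcv _ _ t u0 v0 _ Ft _ _ ucv vcv).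
    - by rewrite t0 ltW.
    - by apply: (cvgr_to_ge ucv); exact: (spending_near Ft adm.1).
    - by apply: (cvgr_to_ge vcv); exact: (spending_near Ft adm.2).
  have Ft : t^'- --> within `[0, T] (nbhs t) by apply: at_left_within; rewrite t0.
  have [_ _ /(_ t)] := pcp; rewrite t0 tT => /(_ isT) /cvg_ex[u0 ucv].
  have [_ _ /(_ t)] := pcq; rewrite t0 tT => /(_ isT) /cvg_ex[v0 vcv].
  apply/cvg_ex; eexists; apply: (gcv _ _ t u0 v0 _ Ft _ _ ucv vcv).
  - by rewrite tT ltW.
  - by apply: (cvgr_to_ge ucv); exact: (spending_near Ft adm.1).
  - by apply: (cvgr_to_ge vcv); exact: (spending_near Ft adm.2).
have [B HB] := gB.
pose f t := expR (- theta * t) *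
  (gamma * derive1 (adoption_level P X) t - (s_p s t + s_q s t)).
have [|||J [J0 JT Jc Jd]] := @integral_primitive R T B D f g T_gt0.
- move=> t tT tD; have /andP[t0 ltT] := tT.
  have tTc : 0 <= t <= T by rewrite !ltW.
  have regt := reg t tTc tD.
  have dS j := let: And3 _ _ h := bass_S_solution (finset1_neq0 j) in h t tT regt.
  have dA : is_derive t 1 (adoption_level P X)
     (- (M%:R^-1 * \sum_(j < M) S_rhs p q (s_p s t) (s_q s t) (survival P X ^~ t) [set j]%SET)).
    apply: (@near_eq_is_derive _ _ _
      (cst 1 - M%:R^-1 \*: (\sum_(j < M) survival P X [set j]%SET))).
      near=> x; rewrite adoption_levelE//.
        rewrite /= fct_sumE. done.
      apply/andP; split; near: x; [exact: lt_le_nbhsr|exact: lt_le_nbhsl].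
    apply: is_derive_eq.
    by rewrite sub0r.
  rewrite /f; have -> : derive1 (adoption_level P X) t =
     - (M%:R^-1 * \sum_(j < M) S_rhs p q (s_p s t) (s_q s t) (survival P X ^~ t) [set j]%SET).
    by rewrite derive1E derive_val.
  rewrite /g /hamiltonian [X in _ = _ + X]big1 ?addr0; last by move=> W _; rewrite mul0r.
  ring.
- move=> t tT tD; have /andP[t0 ltT] := tT.
  have tTc : 0 <= t <= T by rewrite !ltW.
  have regt := reg t tTc tD.
  have [[_ p0] [_ q0]] := adm.
  apply: gcv => //.
  + exact: nbhs_within_itv.
  + exact: p0.
  + exact: q0.
  + exact: (cvg_continuous_on tT regt.1).
  + exact: (cvg_continuous_on tT regt.2).
- by move=> t /andP[t0 tT] _; apply: HB; rewrite !ltW.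
by exists J, D.
Unshelve. all: end_near. Qed.

End ProcessProfit.

(** * Adjoint system *)

Section Adjoint.
Context (R : realType) (M : nat) (p : 'I_M -> R -> R) (q : 'I_M -> 'I_M -> R -> R).
Context (theta gamma : R).
Local Notation sets := {set 'I_M}.

(** Absorbs the discounted income of a sale into the costates of singletons. The income term of the
    Hamiltonian then merges with the costate terms, and the right-hand side of the adjoint system
    becomes linear homogeneous. *)
Definition shifted_costate (t : R) (y : sets -> R) (W : sets) : R :=
  y W - (#|W| == 1)%:R * (gamma / M%:R * expR (- theta * t)).

Lemma hamiltonian_split (t u v : R) (x y : sets -> R) :
  hamiltonian p q theta gamma t x y u v =
  hamiltonian p q theta gamma t x (fun=> 0) u v +
  \sum_(W : sets | W != finset.set0) y W * S_rhs p q u v x W.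
Proof.
rewrite /hamiltonian -[RHS]addrA; congr (_ + _).
by rewrite [X in _ = X + _]big1 ?add0r// => W _; rewrite mul0r.
Qed.

Lemma hamiltonianE (t u v : R) (x y : sets -> R) :
  hamiltonian p q theta gamma t x y u v =
  \sum_(W : sets | W != finset.set0) shifted_costate t y W * S_rhs p q u v x W
  - (u + v) * expR (- theta * t).
Proof.
have single (F : sets -> R) :
    \sum_(W : sets | W != finset.set0) (#|W| == 1)%:R * F W =
    \sum_(j < M) F [set j]%SET.
  have pick1 (j : 'I_M) : F [set j]%SET = \sum_(W : sets) (W == [set j]%SET)%:R * F W.
    rewrite (bigD1 [set j]%SET)//= eqxx mul1r big1 ?addr0// => W /negbTE ->.
    by rewrite mul0r.
  under [RHS]eq_bigr do rewrite pick1.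
  rewrite exchange_big/= big_mkcond/=; apply: eq_bigr => W _.
  rewrite -mulr_suml; have [/cards1P[k ->]|W1] := boolP (#|W| == 1)%N.
    rewrite finset1_neq0 (bigD1 k)//= eqxx big1 ?addr0// => j jk.
    by rewrite (inj_eq finset.set1_inj) eq_sym (negbTE jk).
  rewrite mul0r big1 ?mul0r ?if_same// => j _.
  by case: eqP => // E; rewrite E cards1 in W1.
pose g := gamma / M%:R * expR (- theta * t).
have -> : \sum_(W : sets | W != finset.set0) shifted_costate t y W * S_rhs p q u v x W =
    \sum_(W : sets | W != finset.set0) y W * S_rhs p q u v x W -
    \sum_(W : sets | W != finset.set0) (#|W| == 1)%:R * (g * S_rhs p q u v x W).
  by rewrite -sumrB; apply: eq_bigr => W _; rewrite /shifted_costate /g; ring.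
rewrite (single (fun W => g * S_rhs p q u v x W)) -mulr_sumr /hamiltonian /g; ring.
Qed.

(** [Psi_rhs] is minus the transpose of the linear operator [S_rhs], applied to the shifted
    costates. Transposing means trading the pairs of [W] and [m] in [W] for the pairs of [W :\ m]
    and a node outside it, as in [swap]. *)
Lemma adjoint_identity (t u v : R) (x y : sets -> R) :
  \sum_(W : sets | W != finset.set0)
    Psi_rhs p q theta gamma t u v y W * x W =
  - \sum_(W : sets | W != finset.set0) shifted_costate t y W * S_rhs p q u v x W.
Proof.
pose G (m : 'I_M) (W : sets) := shifted_costate t y W * q_set q m W v * x (m |: W)%SET.
have swap :
    \sum_(W : sets | W != finset.set0)
      \sum_(m in W) (W :\ m != finset.set0)%SET%:R * G m (W :\ m)%SET =
    \sum_(W : sets | W != finset.set0) \sum_(k in (~: W)%SET) G k W.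
  rewrite (exchange_big_dep xpredT)//= [RHS](exchange_big_dep xpredT)//=.
  apply: eq_bigr => m _.
  transitivity (\sum_(W : sets | (m \in W) && (W :\ m != finset.set0)%SET) G m (W :\ m)%SET).
    rewrite big_mkcond [RHS]big_mkcond/=; apply: eq_bigr => W _.
    have [mW|_] := boolP (m \in W); last by rewrite andbF.
    have -> : W != finset.set0 by apply/set0Pn; exists m.
    by rewrite /=; case: ifP => _; rewrite ?mul1r ?mul0r.
  rewrite (reindex_onto (fun W : sets => m |: W)%SET (fun W : sets => W :\ m)%SET)/=; last first.
    by move=> W /andP[mW _]; rewrite finset.setD1K.
  apply: eq_big => [W|W /andP[/andP[_ _] /eqP ->]//].
  rewrite !inE eqxx/=.
  have [mW|mW] := boolP (m \in W).
    rewrite andbF; apply/negbTE; apply/negP => /andP[_ /eqP E].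
    by have := mW; rewrite -E !inE eqxx.
  by rewrite (finset.setU1K mW) eqxx andbT.
(* When [W] has two elements both indicators act and give the shifted costate of a singleton; for
   larger [W] the shift is zero; for a singleton everything vanishes, so the value of [y] at the
   empty set never enters. *)
have coef (W : sets) (m : 'I_M) : m \in W ->
    ((1 < #|W|)%N%:R * y (W :\ m)%SET -
      (#|W| == 2)%:R * (gamma / M%:R * expR (- theta * t))) =
    (W :\ m != finset.set0)%SET%:R * shifted_costate t y (W :\ m)%SET.
  move=> mW; rewrite /shifted_costate (finset.cardsD1 m W) mW add1n ltnS eqSS.
  rewrite -finset.card_gt0.
  case: #|_| => [|n]; rewrite /= ?mul1r// ?mul0r ?subrr//.
rewrite -sumrN.
transitivity (\sum_(W : sets | W != finset.set0)
   (shifted_costate t y W * outflow p q u v W * x W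
    - \sum_(m in W) (W :\ m != finset.set0)%SET%:R * G m (W :\ m)%SET)).
  apply: eq_bigr => W W0; rewrite /Psi_rhs mulrBl; congr (_ - _).
  rewrite mulr_suml; apply: eq_bigr => m mW.
  by rewrite coef// /G finset.setD1K// !mulrA.
rewrite sumrB swap -sumrB; apply: eq_bigr => W _.
rewrite /S_rhs [in RHS]mulrDr [in RHS]mulr_sumr.
rewrite [RHS]opprD; congr (_ + _); first by ring.
by congr (- _); apply: eq_bigr => k _; rewrite mulrA.
Qed.

End Adjoint.

Lemma is_derive_bigsum (R : realType) (I : Type) (r : seq I) (Q : pred I)
    (f : I -> R -> R) (l : I -> R) (t : R) :
  (forall i, Q i -> is_derive t 1 (f i) (l i)) ->
  is_derive t 1 (fun x => \sum_(i <- r | Q i) f i x) (\sum_(i <- r | Q i) l i).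
Proof.
move=> fl; elim: r => [|i r IH].
  rewrite big_nil; under eq_fun do rewrite big_nil; exact: is_derive_cst.
rewrite big_cons; under eq_fun do rewrite big_cons.
by case: ifP => // /fl fi; exact: is_deriveD.
Qed.

(** * Needle variations and the maximum principle *)

Section Needle.
Context (R : realType) (T : R).

Definition needle (s : promotion R) (a b u v : R) : promotion R :=
  Promotion (fun t => if a <= t < b then u else s_p s t)
            (fun t => if a <= t < b then v else s_q s t).

Lemma spending_rate_needle (g : R -> R) (a b c : R) : 0 <= c ->
  spending_rate T g -> spending_rate T (fun t => if a <= t < b then c else g t).
Proof.
move=> c0 [[[D gD] gr gl] g0]; split; last first.
  by move=> t tT; case: ifP => // _; exact: g0.
have cst_or (F : set_system R) (FF : Filter F) (P : bool) : ProperFilter F ->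
    (\forall x \near F, (a <= x < b) = P) -> cvg (g x @[x --> F]) ->
    cvg ((if a <= x < b then c else g x) @[x --> F]).
  move=> PF HP /cvg_ex[l gl']; apply/cvg_ex.
  exists (if P then c else l).
  case: P HP => HP.
    by apply: cvg_near_cst; near=> x; have -> // : (a <= x < b) = true by near: x.
  apply: cvg_trans gl'; apply: near_eq_cvg; near=> x.
  by have -> // : (a <= x < b) = false by near: x.
split.
- exists [:: a, b & D] => t tT; rewrite !inE !negb_or => /and3P[ta tb tD].
  have near_const : \forall x \near t, (a <= x < b) = (a <= t < b).
    have na : \forall x \near t, (a <= x) = (a <= t).
      move: ta; rewrite neq_lt => /orP[ta|at_].
        near=> x; rewrite [RHS]leNgt ta/= leNgt; apply/negbTE; rewrite negbK.
        by near: x; exact: lt_nbhsl.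
      by near=> x; rewrite (ltW at_); near: x; exact: lt_le_nbhsr.
    have nb : \forall x \near t, (x < b) = (t < b).
      move: tb; rewrite neq_lt => /orP[tb|bt].
        by near=> x; rewrite tb; near: x; exact: lt_nbhsl.
      near=> x; rewrite [RHS]ltNge (ltW bt)/= ltNge; apply/negbTE; rewrite negbK.
      by near: x; exact: lt_le_nbhsr.
    near=> x; congr andb; by near: x.
  have [tab|tab] := boolP (a <= t < b).
    rewrite tab in near_const; apply: (@continuous_on_eq _ _ _ (cst c)).
      by apply: filterS near_const => x ->.
    rewrite /continuous_on_at; exact: cvg_cst.
  rewrite (negbTE tab) in near_const; apply: (@continuous_on_eq _ _ _ g).
    by apply: filterS near_const => x ->.
  exact: gD.
- move=> t tT; apply: (cst_or _ _ (a <= t < b)); last exact: gr.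
  have na : \forall x \near t^'+, (a <= x) = (a <= t).
    have [ta|at_] := ltP t a.
      by near=> x; apply/negbTE; rewrite -ltNge; near: x; exact: nbhs_right_lt.
    by near=> x; apply: (le_trans at_); apply: ltW; near: x; exact: nbhs_right_gt.
  have nb : \forall x \near t^'+, (x < b) = (t < b).
    have [tb|bt] := ltP t b; first by near=> x; near: x; exact: nbhs_right_lt.
    near=> x; apply/negbTE; rewrite -leNgt; apply: (le_trans bt); apply: ltW.
    by near: x; exact: nbhs_right_gt.
  by near=> x; congr andb; near: x.
(* Just to the left of [t], membership in the half-open interval is decided by [a < t <= b] instead
   of [a <= t < b]. *)
- move=> t tT; apply: (cst_or _ _ (a < t <= b)); last exact: gl.
  have na : \forall x \near t^'-, (a <= x) = (a < t).
    have [at_|ta] := ltP a t; first by near=> x; near: x; exact: nbhs_left_ge.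
    near=> x; apply/negbTE; rewrite -ltNge; apply: lt_le_trans ta.
    by near: x; exact: nbhs_left_lt.
  have nb : \forall x \near t^'-, (x < b) = (t <= b).
    have [tb|bt] := leP t b.
      by near=> x; apply: lt_le_trans tb; near: x; exact: nbhs_left_lt.
    by near=> x; apply/negbTE; rewrite -leNgt; near: x; exact: nbhs_left_ge.
  by near=> x; congr andb; near: x.
Unshelve. all: end_near. Qed.

Lemma admissible_needle (s : promotion R) (a b u v : R) : 0 <= u -> 0 <= v ->
  admissible T s -> admissible T (needle s a b u v).
Proof. by move=> u0 v0 [sp sq]; split; exact: spending_rate_needle. Qed.

End Needle.

(* The costates are those of [s], whereas the survival probabilities and the
   profit are those of [s']: by [adjoint_identity] the derivative of the
   partial profit plus [\sum_W Psi W * S' W] only involves the difference of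
   the Hamiltonians at [s'] and at [s]. *)
Lemma profit_value (R : realType) (M : nat) (p : 'I_M -> R -> R)
    (q : 'I_M -> 'I_M -> R -> R) (T theta gamma : R)
    d (Om : measurableType d) (P : probability Om R)
    (X : 'I_M -> R -> Om -> bool) (s s' : promotion R)
    (Psi : {set 'I_M} -> R -> R) :
  (0 < M)%N -> (forall j, influence_rate (p j)) ->
  (forall k j, influence_rate (q k j)) -> 0 < T ->
  admissible T s -> admissible T s' -> bass_process p q P X T s' ->
  Psi_solution p q T theta gamma s Psi ->
  let S' := survival P X in
  exists (K : R -> R) (E : seq R), [/\
    K 0 = \sum_(W : {set 'I_M} | W != finset.set0) Psi W 0,
    K T = profit P X T theta gamma s',
    forall t, 0 <= t <= T -> continuous_on_at T K t &
    forall t, 0 < t < T -> t \notin E -> is_derive t 1 K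
      (hamiltonian p q theta gamma t (S' ^~ t) (Psi ^~ t) (s_p s' t) (s_q s' t)
       - hamiltonian p q theta gamma t (S' ^~ t) (Psi ^~ t) (s_p s t) (s_q s t)
       - (s_p s t + s_q s t) * expR (- theta * t))].
Proof.
move=> M_gt0 hp hq T0 adm adm' bass hPsi S'.
have [J [E [J0 JT Jc Jd]]] := profit_primitive hp hq T0 adm' bass M_gt0 theta gamma.
have hS' := bass_S_solution hp hq T0 adm' bass.
have [D reg] := admissible_regular adm; have [D' reg'] := admissible_regular adm'.
(* The boundary conditions fix both ends: [S'] is one at [0], so the initial value is the same for
   all [s'], and [Psi] vanishes at [T], which leaves the profit. *)
exists (fun t => J t + \sum_(W : {set 'I_M} | W != finset.set0) Psi W t * S' W t).
exists (E ++ D ++ D'); split.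
- rewrite J0 add0r; apply: eq_bigr => W W0.
  by have [_ SW0 _] := hS' W W0; rewrite /S' SW0 mulr1.
- rewrite JT big1 ?addr0// => W W0.
  by have [_ -> _] := hPsi W W0; rewrite mul0r.
- move=> t tT; apply: cvgD; first exact: Jc.
  apply: cvg_sumr => W W0; apply: cvgM.
    by have [+ _ _] := hPsi W W0; apply.
  by have [+ _ _] := hS' W W0; apply.
- move=> t tT; rewrite !mem_cat !negb_or => /and3P[tE tD tD'].
  have tTc : 0 <= t <= T by case/andP: tT => *; rewrite !ltW.
  pose dPsi W := Psi_rhs p q theta gamma t (s_p s t) (s_q s t) (Psi ^~ t) W.
  pose dS W := S_rhs p q (s_p s' t) (s_q s' t) (S' ^~ t) W.
  have dsum : is_derive t 1
      (fun x => \sum_(W : {set 'I_M} | W != finset.set0) Psi W x * S' W x)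
      (\sum_(W : {set 'I_M} | W != finset.set0) (dPsi W * S' W t + Psi W t * dS W)).
    apply: is_derive_bigsum => W W0.
    have [_ _ /(_ t tT (reg t tTc tD)) d1] := hPsi W W0.
    have [_ _ /(_ t tT (reg' t tTc tD')) d2] := hS' W W0.
    apply: is_derive_eq; rewrite /dPsi /dS /GRing.scale/=; ring.
  apply: (is_derive_eq (is_deriveD (Jd t tT tE) dsum)).
  rewrite big_split/= adjoint_identity.
  rewrite [in RHS](hamiltonian_split _ _ _ _ _ (s_p s' t)).
  rewrite [X in _ = _ - X - _]hamiltonianE//; ring.
Qed.

Lemma hamiltonian_eq (R : realType) (M : nat) (p : 'I_M -> R -> R)
    (q : 'I_M -> 'I_M -> R -> R) (theta gamma t u v : R)
    (x x' y : {set 'I_M} -> R) :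
  (forall W, W != finset.set0 -> x W = x' W) ->
  hamiltonian p q theta gamma t x y u v = hamiltonian p q theta gamma t x' y u v.
Proof.
move=> xx'.
have SE W : W != finset.set0 -> S_rhs p q u v x W = S_rhs p q u v x' W.
  move=> W0; rewrite /S_rhs xx'//; congr (_ + _); apply: eq_bigr => k _.
  by rewrite xx'//; apply/set0Pn; exists k; rewrite !inE eqxx.
rewrite /hamiltonian; congr ((_ * _ - _) * _ + _).
  by apply: eq_bigr => j _; exact/SE/finset1_neq0.
by apply: eq_bigr => W W0; rewrite SE.
Qed.

Section MaximumPrinciple.
Context (R : realType) (M : nat) (M_gt0 : (0 < M)%N).
Context (p : 'I_M -> R -> R) (q : 'I_M -> 'I_M -> R -> R).
Context (hp : forall j, influence_rate (p j))
  (hq : forall k j, influence_rate (q k j)).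
Context (T theta gamma : R) (T_gt0 : 0 < T).
Context (d : measure_display) (Om : promotion R -> measurableType d)
  (P : forall s : promotion R, probability (Om s) R)
  (X : forall s : promotion R, 'I_M -> R -> Om s -> bool).
Context (hX : forall s : promotion R, admissible T s ->
  bass_process p q (P s) (@X s) T s).
Context (s : promotion R) (S Psi : {set 'I_M} -> R -> R).
Context (hs : admissible T s) (hS : S_solution p q T s S)
  (hPsi : Psi_solution p q T theta gamma s Psi).
Context (s_opt : forall s' : promotion R, admissible T s' ->
  profit (P s') (@X s') T theta gamma s' <= profit (P s) (@X s) T theta gamma s).

Let H (x : {set 'I_M} -> R -> R) (t u v : R) :=
  hamiltonian p q theta gamma t (x ^~ t) (Psi ^~ t) u v.

Let H_cvg (F : set_system R) (FF : Filter F) (t : R) (x : {set 'I_M} -> R -> R)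
    (u v : R -> R) :
  0 <= t <= T -> F --> within `[0, T] (nbhs t) ->
  (forall W, W != finset.set0 -> continuous_on_at T (x W) t) ->
  (forall t, 0 <= t <= T -> 0 <= u t) -> (forall t, 0 <= t <= T -> 0 <= v t) ->
  continuous_on_at T u t -> continuous_on_at T v t ->
  H x t' (u t') (v t') @[t' --> F] --> H x t (u t) (v t).
Proof.
move=> tT Ft xc u0 v0 uc vc.
have cF (f : R -> R) : continuous_on_at T f t -> f x @[x --> F] --> f t.
  by apply: cvg_trans; exact: cvg_app Ft.
have near_T : \forall x \near F, 0 <= x <= T.
  apply: Ft; near=> y.
  suff : [set` `[0, T]] y by rewrite /= in_itv.
  by near: y; exact: withinT.
apply: (@hamiltonian_cvg _ _ p q theta gamma F FF u v x Psi) => //.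
- by move=> A HA; apply: Ft; exact: cvg_within HA.
- exact: u0.
- by apply: filterS near_T => y /u0.
- exact: cF.
- exact: v0.
- by apply: filterS near_T => y /v0.
- exact: cF.
- by move=> W W0; apply: cF; exact: xc.
- by move=> W W0; apply: cF; have [+ _ _] := hPsi W0; apply.
Unshelve. all: end_near. Qed.

Let S_needle (a b u v : R) := survival (P (needle s a b u v)) (@X (needle s a b u v)).

Let S_needleP a b u v : 0 <= u -> 0 <= v ->
  S_solution p q T (needle s a b u v) (S_needle a b u v).
Proof.
move=> u0 v0; have adm := admissible_needle a b u0 v0 hs.
exact: (bass_S_solution hp hq T_gt0 adm (hX adm)).
Qed.

Lemma maximum_principle_lt (t u v : R) : 0 <= t < T -> regular_time T s t ->
  0 <= u -> 0 <= v -> H S t u v <= H S t (s_p s t) (s_q s t).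
Proof.
move=> tT [regp regq] u0 v0; rewrite leNgt; apply/negP => Hlt.
have /andP[t0 ltT] := tT; have tTc : 0 <= t <= T by rewrite t0 ltW.
(* An auxiliary needle up to [T]: its survival probabilities do not refer to the length [e - t],
   which is still to be chosen. *)
pose s1 := needle s t T u v.
have adm1 : admissible T s1 := admissible_needle t T u0 v0 hs.
pose S1 := S_needle t T u v.
have sol1 : S_solution p q T s1 S1 := S_needleP t T u0 v0.
have S1t W : W != finset.set0 -> S1 W t = S W t.
  move=> W0; apply: (S_solution_unique hp hq (ltW ltT) adm1 hs _ sol1 hS) => //; last first.
    by rewrite t0 lexx.
  by move=> x /andP[x0 xt]; rewrite /= leNgt xt.
have HS1 a b : H S1 t a b = H S t a b by exact: hamiltonian_eq.
(* Rate of gain at [x] from spending [(u, v)] instead of [s]. It is positive at [t], where [S1] and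
   [S] agree, and stays above half that value on some interval to the right. *)
pose phi x := H S1 x u v - H S1 x (s_p s x) (s_q s x).
have phi_cvg : phi x @[x --> t^'+] --> phi t.
  have Ft : t^'+ --> within `[0, T] (nbhs t) by exact: at_right_within.
  have S1c W : W != finset.set0 -> continuous_on_at T (S1 W) t.
    by move=> W0; have [+ _ _] := sol1 W W0; apply.
  have [[_ p0] [_ q0]] := hs.
  apply: cvgB; last exact: (H_cvg _ tTc Ft).
  by apply: (@H_cvg _ _ _ _ (fun=> u) (fun=> v)) => //; exact: cvg_cst.
have phit : 0 < phi t by rewrite /phi !HS1 subr_gt0.
pose eta := phi t / 2.
have eta0 : 0 < eta by rewrite divr_gt0.
have [e /andP[te eT] phie] : exists2 e, t < e <= T & forall y, t < y <= e -> eta <= phi y.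
  have eta_lt : eta < phi t by rewrite ltr_pdivrMr// ltr_pMr// ltr1n.
  apply: right_nbhs_interval => //.
  exact: cvgr_ge phi_cvg _ eta_lt.
(* The needle that is actually tested. It agrees with [s1] before [e], so by uniqueness [phi] also
   measures its gain up to [e]. *)
pose s2 := needle s t e u v.
have adm2 : admissible T s2 := admissible_needle t e u0 v0 hs.
pose S2 := S_needle t e u v.
have S21 W x : W != finset.set0 -> 0 <= x <= e -> S2 W x = S1 W x.
  move=> W0 xe; apply: (S_solution_unique hp hq eT adm2 adm1 _ (S_needleP t e u0 v0) sol1) => //.
  move=> y /andP[y0 ye]; rewrite /= ye (lt_le_trans ye eT).
  by case: (t <= y).
have HS21 x a b : 0 <= x <= e -> H S2 x a b = H S1 x a b.
  by move=> xe; apply: hamiltonian_eq => W W0; exact: S21.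
have [K2 [E2 [K20 K2T K2c K2d]]] :=
  profit_value M_gt0 hp hq T_gt0 hs adm2 (hX adm2) hPsi.
have [K0 [E0 [K00 K0T K0c K0d]]] :=
  profit_value M_gt0 hp hq T_gt0 hs hs (hX hs) hPsi.
(* Starts at zero and ends at the difference of the profits. In [K0] the two Hamiltonians are equal,
   and the spending terms of [K2] and [K0] cancel. *)
pose Del := K2 - K0.
have Delc x : 0 <= x <= T -> continuous_on_at T Del x.
  by move=> xT; apply: cvgB; [exact: K2c|exact: K0c].
have Deld x : 0 < x < T -> x \notin E2 ++ E0 ->
    is_derive x 1 Del (H S2 x (s_p s2 x) (s_q s2 x) - H S2 x (s_p s x) (s_q s x)).
  move=> xT; rewrite mem_cat negb_or => /andP[xE2 xE0].
  apply: (is_derive_eq (is_deriveB (K2d x xT xE2) (K0d x xT xE0))).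
  rewrite /H; ring.
(* Before [t], and again after [e], the promotions [s2] and [s] agree, so both Hamiltonians, taken
   at the same [S2], cancel. *)
have Del0t : Del 0 <= Del t.
  apply: (@derive_mono _ _ _ _ (E2 ++ E0)) => //.
    move=> x /andP[x0 xt]; apply: (continuous_on_atS (ltW ltT)); apply: Delc.
    by rewrite x0 (le_trans xt (ltW ltT)).
  move=> x /andP[x0 xt] xE; exists 0 => //.
  apply: (is_derive_eq (Deld x _ xE)); first by rewrite x0 (lt_trans xt).
  by rewrite /s2/= leNgt xt/= subrr.
have DeleT : Del e <= Del T.
  apply: (@derive_mono _ _ _ _ (E2 ++ E0)) => //.
    move=> x /andP[ex xT]; apply: (cvg_withinS (B := `[0, T])).
      by apply: subset_itvcc => //; rewrite (le_trans t0)// ltW.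
    by apply: Delc; rewrite xT andbT (le_trans t0)// (le_trans (ltW te)).
  move=> x /andP[ex xT] xE; exists 0 => //.
  apply: (is_derive_eq (Deld x _ xE)).
    by rewrite xT andbT (le_lt_trans t0)// (lt_trans te).
  by rewrite /s2/= [x < e]ltNge (ltW ex) andbF subrr.
have Delte : Del t - eta * t <= Del e - eta * e.
  apply: (@derive_mono _ _ _ (fun x => Del x - eta * x) (E2 ++ E0)); first exact: ltW.
    move=> x /andP[tx xe]; apply: (cvg_withinS (B := `[0, T])).
      by apply: subset_itvcc.
    apply: cvgB; first by apply: Delc; rewrite (le_trans t0 tx) (le_trans xe eT).
    apply: cvgM; first exact: cvg_cst.
    by apply: cvg_within_filter; exact: cvg_id.
  move=> x /andP[tx xe] xE; exists (phi x - eta).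
    by rewrite subr_ge0 phie// tx ltW.
  have xT : 0 < x < T by rewrite (le_lt_trans t0 tx) (lt_le_trans xe eT).
  have Dx := Deld x xT xE.
  have -> : (fun x => Del x - eta * x) = Del - (eta \*: id) by [].
  apply: is_derive_eq.
  have xe0 : 0 <= x <= e by rewrite (le_trans t0 (ltW tx)) ltW.
  rewrite /s2/= (ltW tx) xe /phi !HS21//.
  by rewrite [_ *: 1]mulr1.
have : Del T <= 0.
  have -> : Del T = K2 T - K0 T by [].
  by rewrite K2T K0T subr_le0; exact: s_opt.
have : Del 0 = 0 by rewrite [LHS](_ : _ = K2 0 - K0 0)// K20 K00 subrr.
have : 0 < eta * (e - t) by rewrite mulr_gt0// subr_gt0.
lra.
Qed.

(** No needle fits to the right of [T], so the inequality at [T] is a limit of those at earlier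
    regular times. *)
Lemma maximum_principle (t u v : R) : 0 <= t <= T -> regular_time T s t ->
  0 <= u -> 0 <= v -> H S t u v <= H S t (s_p s t) (s_q s t).
Proof.
move=> /andP[t0]; rewrite le_eqVlt => /predU1P[->|tT] reg u0 v0; last first.
  by apply: maximum_principle_lt => //; rewrite t0.
have TT : 0 <= T <= T by rewrite lexx ltW.
have Ft : T^'- --> within `[0, T] (nbhs T) by apply: at_left_within; rewrite lexx T_gt0.
have Sc W : W != finset.set0 -> continuous_on_at T (S W) T.
  by move=> W0; have [+ _ _] := hS W0; apply.
have [[_ p0] [_ q0]] := hs; have [regp regq] := reg.
have [D HD] := admissible_regular hs.
have cv1 : H S x u v @[x --> T^'-] --> H S T u v.
  by apply: (@H_cvg _ _ _ _ (fun=> u) (fun=> v)) => //; exact: cvg_cst.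
have cv2 : H S x (s_p s x) (s_q s x) @[x --> T^'-] --> H S T (s_p s T) (s_q s T).
  exact: (H_cvg _ TT Ft).
apply: (ler_cvg_to cv1 cv2).
(* [T] may itself belong to [D]; once it is removed, a neighbourhood of [T] avoids the remaining
   points. *)
have nD : \forall x \near T^'-, x \notin [seq z <- D | z != T].
  have : \forall x \near T, x \notin [seq z <- D | z != T].
    by apply: notin_near; rewrite mem_filter eqxx.
  exact: cvg_within.
near=> x.
have xT : x < T by near: x; exact: nbhs_left_lt.
have x0 : 0 <= x by near: x; exact: nbhs_left_ge.
apply: maximum_principle_lt => //; first by rewrite x0.
apply: HD; first by rewrite x0 ltW.
have : x \notin [seq z <- D | z != T] by near: x.
by rewrite mem_filter lt_eqF.
Unshelve. all: end_near. Qed.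

End MaximumPrinciple.

(** * Interior maxima of the Hamiltonian in the spending rates *)

Lemma derivable_bigsum (R : realType) (I : Type) (r : seq I) (Q : pred I)
    (f : I -> R -> R) (t : R) :
  (forall i, Q i -> derivable (f i) t 1) ->
  derivable (fun x => \sum_(i <- r | Q i) f i x) t 1.
Proof.
move=> fd; apply: (@ex_derive _ _ _ _ _ _ (\sum_(i <- r | Q i) 'D_1 (f i) t)).
by apply: is_derive_bigsum => i /fd/derivableP.
Qed.

Section HamiltonianDerivative.
Context (R : realType) (M : nat) (p : 'I_M -> R -> R) (q : 'I_M -> 'I_M -> R -> R).
Context (hp : forall j, influence_rate (p j))
  (hq : forall k j, influence_rate (q k j)).
Context (theta gamma t : R) (x y : {set 'I_M} -> R).

(** Serves both partial derivatives: one of [U] and [V] is the identity and the other is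
    constant. *)
Lemma hamiltonian_derivable (U V : R -> R) (r : R) :
  (forall W, derivable (fun z => S_rhs p q (U z) (V z) x W) r 1) ->
  derivable U r 1 -> derivable V r 1 ->
  derivable (fun z => hamiltonian p q theta gamma t x y (U z) (V z)) r 1.
Proof.
move=> dS dU dV; apply: derivableD.
  apply: derivableM; last exact: derivable_cst.
  apply: derivableB; last exact: derivableD.
  apply: derivableM; first exact: derivable_cst.
  by apply: derivable_bigsum => j _; exact: dS.
apply: derivable_bigsum => W _.
by apply: derivableM; [exact: derivable_cst|exact: dS].
Qed.

Lemma hamiltonian_derivable_p (u v : R) : 0 < u ->
  derivable (fun z => hamiltonian p q theta gamma t x y z v) u 1.
Proof.
move=> u0; apply: (hamiltonian_derivable (U := id) (V := fun=> v)).
- move=> W; apply: derivableD; last exact: derivable_cst.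
  apply: derivableM; last exact: derivable_cst.
  apply: derivableN; apply: derivableD; last exact: derivable_cst.
  by apply: derivable_bigsum => j _; have [_ _] := hp j; apply.
- exact: derivable_id.
- exact: derivable_cst.
Qed.

Lemma hamiltonian_derivable_q (u v : R) : 0 < v ->
  derivable (fun z => hamiltonian p q theta gamma t x y u z) v 1.
Proof.
move=> v0; have dq k W : derivable (fun z => q_set q k W z) v 1.
  by apply: derivable_bigsum => j _; have [_ _] := hq k j; apply.
apply: (hamiltonian_derivable (U := fun=> u) (V := id)).
- move=> W; apply: derivableD.
    apply: derivableM; last exact: derivable_cst.
    apply: derivableN; apply: derivableD; first exact: derivable_cst.
    by apply: derivable_bigsum.
  by apply: derivable_bigsum => k _; apply: derivableM; [exact: dq|exact: derivable_cst].
- exact: derivable_cst.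
- exact: derivable_id.
Qed.

End HamiltonianDerivative.

(** The rates may be singular at zero spending, so the maximum is compared with positive values
    only; [c + 1] is just a right end for an open interval around [c]. *)
Lemma derive_at_positive_max (R : realType) (f : R -> R) (c : R) : 0 < c ->
  (forall x, 0 < x -> derivable f x 1) -> (forall x, 0 < x -> f x <= f c) ->
  is_derive c 1 f 0.
Proof.
move=> c0 df fmax; have c1 : c < c + 1 by rewrite ltrDl.
apply: (@derive1_at_max _ f 0 (c + 1)).
- by rewrite ltW// (lt_trans c0).
- by move=> z; rewrite in_itv/= => /andP[z0 _]; exact: df.
- by rewrite in_itv/= c0.
- by move=> z; rewrite in_itv/= => /andP[z0 _]; exact: fmax.
Qed.

Unset Implicit Arguments.

Theorem theorem1 (R : realType) (M : nat) (M_gt0 : (0 < M)%N)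
  (p : 'I_M -> R -> R) (q : 'I_M -> 'I_M -> R -> R)
  (hp : forall j, influence_rate (p j))
  (hq : forall k j, influence_rate (q k j))
  (T theta gamma : R) (T_gt0 : 0 < T)
  (d : measure_display) (Om : promotion R -> measurableType d)
  (P : forall s : promotion R, probability (Om s) R)
  (X : forall s : promotion R, 'I_M -> R -> Om s -> bool)
  (hX : forall s : promotion R, admissible T s ->
     bass_process p q (P s) (X s) T s)
  (s : promotion R) (S Psi : {set 'I_M} -> R -> R)
  (hs : admissible T s)
  (hS : S_solution p q T s S)
  (hPsi : Psi_solution p q T theta gamma s Psi)
  (s_opt : forall s' : promotion R, admissible T s' ->
     profit (P s') (X s') T theta gamma s'
       <= profit (P s) (X s) T theta gamma s) :
  forall t : R, 0 <= t <= T -> regular_time T s t ->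
    (0 < s_p s t ->
       is_derive (s_p s t) 1
         (fun u => hamiltonian p q theta gamma t (S ^~ t) (Psi ^~ t)
                     u (s_q s t)) 0)
    /\
    (0 < s_q s t ->
       is_derive (s_q s t) 1
         (fun v => hamiltonian p q theta gamma t (S ^~ t) (Psi ^~ t)
                     (s_p s t) v) 0).
Proof.
move=> t tT reg; have [[_ p0] [_ q0]] := hs.
have Hmax := maximum_principle M_gt0 hp hq T_gt0 hX hs hS hPsi s_opt tT reg.
split=> [sp0|sq0]; apply: derive_at_positive_max => //.
- by move=> u u0; exact: hamiltonian_derivable_p.
- by move=> u u0; apply: Hmax; [exact: ltW|exact: q0].
- by move=> v v0; exact: hamiltonian_derivable_q.
- by move=> v v0; apply: Hmax; [exact: p0|exact: ltW].
Qed.
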